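(* Let $(X_t)_{t\ge0}$ be a time-homogeneous continuous-time Markov process with countable state space $S$ (transition rates not assumed symmetric), let $i\in S$, and suppose $p_t(i,i)\sim ct^{-\alpha}$ as $t\to\infty$ for some $c,\alpha>0$. Let $L_t=\int_0^t\mathbf 1_{\{X_s=i\}}\,ds$ for the process started in $i$. If $\kappa<0$, then, as $t\to\infty$, $$\mathbb{E}[e^{\kappa L_t}]\sim\begin{cases}\frac{1}{t^{1-\alpha}}\,\frac{1}{-\kappa c\,\Gamma(1-\alpha)\Gamma(\alpha)}&:0<\alpha<1,\\[1ex] \frac1{\log t}\,\frac{1}{-\kappa c}&:\alpha=1,\\[1ex] \frac{1}{-\kappa G_\infty+1}&:\alpha>1.\end{cases}$$
   Context: $p_t(i,j)=\mathbb{P}[X_t=j\mid X_0=i]$; the process is a (conservative) continuous-time Markov chain with right-continuous paths. $G_\infty=\int_0^\infty p_t(i,i)\,dt$. $h_1\sim h_2$ means $\lim h_1/h_2=1$; $\Gamma$ is the Gamma function. *)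

(* Defs.v *)
From HB Require Import structures.
From mathcomp Require Import all_boot all_order all_algebra.
From mathcomp Require Import all_classical all_reals all_analysis.

Set Implicit Arguments.
Unset Strict Implicit.
Unset Printing Implicit Defensive.

Import Order.TTheory GRing.Theory Num.Theory.
Import numFieldNormedType.Exports.

Local Open Scope classical_set_scope.
Local Open Scope ring_scope.

(* [P i] is the law of the process started in [i].  The process is indexed by
   all of [R], but only its values at times [0 <= t] are ever constrained or
   used.  The state space carries the discrete topology and the discrete
   sigma-algebra.  As [X t w] is a state for every [t], the process is
   conservative: the probabilities [P i (X t = j)] sum to 1 over [j]. *)
Record markov_process (R : realType) (d : measure_display)
    (Omega : measurableType d) (S : countType)
    (P : S -> probability Omega R) (X : R -> Omega -> S) : Prop :=
  MarkovProcess {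
    markov_measurable : forall (t : R) (j : S), 0 <= t ->
      measurable [set w | X t w = j] ;
    (* a neighbourhood base of [X t w] is the singleton [[set X t w]] *)
    markov_right_continuous : forall (w : Omega) (t : R), 0 <= t ->
      \forall s \near t^'+, X s w = X t w ;
    markov_start : forall i : S, P i [set w | X 0 w = i] = 1%E ;
    (* Time-homogeneous Markov property, for the past at the times
       [t 0 <= ... <= t n]; it is written in product form so that no
       conditioning on a null event occurs. *)
    markov_property : forall (i : S) (n : nat) (t : nat -> R) (x : nat -> S)
        (u : R) (j : S),
      0 <= t 0%N -> (forall m, (m < n)%N -> t m <= t m.+1) -> 0 <= u ->
      let past := [set w | forall m, (m <= n)%N -> X (t m) w = x m] in
      P i (past `&` [set w | X (t n + u) w = j]) =
        (P i past * P (x n) [set w | X u w = j])%E }.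

Definition transition_prob (R : realType) (d : measure_display)
    (Omega : measurableType d) (S : countType)
    (P : S -> probability Omega R) (X : R -> Omega -> S)
    (t : R) (i j : S) : R :=
  fine (P i [set w | X t w = j]).

Definition local_time (R : realType) (d : measure_display)
    (Omega : measurableType d) (S : countType)
    (X : R -> Omega -> S) (i : S) (t : R) (w : Omega) : R :=
  \int[lebesgue_measure]_(s in `[0, t]) \1_[set r | X r w = i] s.

Definition green (R : realType) (d : measure_display)
    (Omega : measurableType d) (S : countType)
    (P : S -> probability Omega R) (X : R -> Omega -> S) (i : S) : \bar R :=
  (\int[lebesgue_measure]_(t in `[0%R, +oo[) (transition_prob P X t i i)%:E)%E.

(* Euler's integral; meaningful for [0 < a]. *)
Definition Gamma (R : realType) (a : R) : R :=
  \int[lebesgue_measure]_(x in `]0, +oo[) (x `^ (a - 1) * expR (- x)).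

Definition asymp_equiv (R : realType) (h1 h2 : R -> R) : Prop :=
  h1 t / h2 t @[t --> +oo] --> (1 : R).

(* Main.v *)
(* Write [h t = E exp (kappa L_t)], [lam = - kappa], [p t = p_t(i,i)].  Decomposing
   according to the visits to [i] gives the renewal equation [h + lam (p * h) = 1].
   It is proved first for the skeleton chain of mesh [t / N], where [exp (kappa L)]
   is a product over the grid, and passes to the limit by dominated convergence.
   As [h] is nonincreasing, no Tauberian theorem is needed.  With
   [G t = int_0^t p], the equation gives [h (1 + lam G) <= 1], and also
   [h (1 + lam G) --> 1] if [alpha >= 1].  If [alpha < 1], convolving the equation
   with [t^(alpha - 1)] gives
   [lam c Gamma(alpha) Gamma(1 - alpha) int_0^t h ~ t^alpha / alpha], which can be
   differentiated because [h] is monotone. *)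

Require Import Defs.
From HB Require Import structures.
From mathcomp Require Import all_boot all_order all_algebra.
From mathcomp Require Import all_classical all_reals all_analysis.
From mathcomp Require Import ring lra.

Set Implicit Arguments.
Unset Strict Implicit.
Unset Printing Implicit Defensive.

Import Order.TTheory GRing.Theory Num.Theory.
Import numFieldNormedType.Exports measurable_realfun.

Local Open Scope classical_set_scope.
Local Open Scope ring_scope.

(** * Convolutions of nonnegative functions *)

Section affine.
Context {R : realType}.
Local Notation mu := (@lebesgue_measure R).
Local Open Scope ereal_scope.

(** Pathwise, [1 - exp (kappa L_t)] is [lam] times the integral over [s] in [[0, t]] of
    [1_(X_s = i) exp (kappa (L_t - L_s))], and the renewal equation is its expectation. The last
    factor depends on the whole path after [s], whereas the Markov property speaks of finitely many
    times; on a grid the identity is a telescoping product and involves finitely many times. For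
    [alpha >= 1] the function [G] gives the sharp constant because visits at times comparable with
    [t] contribute nothing to [p * h] in the limit. For [alpha < 1] they do contribute:
    [h (1 + lam G)] tends to a limit below 1, for instance [2 / pi] if [alpha = 1/2], so another
    test function is required. The power [t^(alpha - 1)] is chosen because its convolution with
    [t^(- alpha)] is constant, equal to [Gamma(alpha) Gamma(1 - alpha)]. It turns [p] into nearly a
    multiple of the Heaviside function, and convolving [h] with the latter yields its primitive. *)

Lemma measurable_affine (a b : R) :
  measurable_fun [set: R] (fun x : R => a * x + b)%R.
Proof. by apply: measurable_funD => //; exact: mulrl_measurable. Qed.

(** The rescaled image measure agrees with Lebesgue measure on the intervals []x, y]], which
    determine it. *)
Lemma lebesgue_measure_affine (a b : R) (A : set R) : (0 < a)%R -> measurable A ->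
  lebesgue_measure A = (a%:E * mu ((fun x => a * x + b)%R @^-1` A)).
Proof.
move=> a0 mA.
pose phi : measurableTypeR R -> measurableTypeR R := fun x => (a * x + b)%R.
have mphi : measurable_fun setT phi by exact: measurable_affine.
pose nu : {measure set (measurableTypeR R) -> \bar R} :=
  mscale (NngNum (ltW a0)) (pushforward mu phi).
rewrite (@lebesgue_measure_unique R (nu mphi))// => _ [[x y]] _ <-.
rewrite /= /mscale/= /pushforward.
have -> : phi @^-1` `]x, y] = `]((x - b) / a)%R, ((y - b) / a)%R]%classic.
  apply/seteqP; split => z /=; rewrite !in_itv/= /phi ltr_pdivrMr// ler_pdivlMr//;
    by rewrite ltrBlDr lerBrDr mulrC.
rewrite !lebesgue_measure_itv/= !lte_fin ltr_pM2r ?invr_gt0// ltrD2r.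
case: ifPn => _; last by rewrite mule0.
rewrite -!EFinD -EFinM; congr EFin; field; exact: lt0r_neq0.
Qed.

Lemma ge0_integral_affine (f : R -> \bar R) (a b : R) : (0 < a)%R ->
  measurable_fun [set: R] f -> (forall x, 0 <= f x) ->
  \int[mu]_x f x = a%:E * \int[mu]_x f (a * x + b)%R.
Proof.
move=> a0 mf f0.
pose phi : measurableTypeR R -> measurableTypeR R := fun x => (a * x + b)%R.
have mphi : measurable_fun setT phi by exact: measurable_affine.
have := @ge0_integral_pushforward _ _ _ _ R phi mphi mu setT f measurableT mf.
rewrite preimage_setT => /(_ _) <-; last by [].
pose nu : {measure set (measurableTypeR R) -> \bar R} :=
  mscale (NngNum (ltW a0)) (pushforward mu phi).
transitivity (\int[nu mphi]_x f x).
  apply: (@eq_measure_integral _ _ _ _ (nu mphi)) => A mA _.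
  exact: (lebesgue_measure_affine _ a0 mA).
by rewrite /nu ge0_integral_mscale.
Qed.

Lemma ge0_integral_shift (f : R -> \bar R) (b : R) :
  measurable_fun [set: R] f -> (forall x, 0 <= f x) ->
  \int[mu]_x f (x - b)%R = \int[mu]_x f x.
Proof.
move=> mf f0; rewrite [RHS](@ge0_integral_affine f 1 (- b))// mul1e.
by apply: eq_integral => x _; rewrite mul1r.
Qed.

Lemma ge0_integral_reflect (f : R -> \bar R) (b : R) :
  measurable_fun [set: R] f -> (forall x, 0 <= f x) ->
  \int[mu]_x f (b - x)%R = \int[mu]_x f x.
Proof.
move=> mf f0.
pose phi : measurableTypeR R -> measurableTypeR R := -%R.
have mphi : measurable_fun setT phi by exact: oppr_measurable.
rewrite -(ge0_integral_shift (- b) mf f0).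
have mg : measurable_fun [set: R] (fun x => f (x - - b)%R).
  by apply: measurableT_comp => //; exact: measurable_funB.
transitivity (\int[mu]_x ((fun x => f (x - - b)%R) \o phi) x).
  by apply: eq_integral => x _; rewrite /= /phi opprK addrC.
have <- := @ge0_integral_pushforward _ _ _ _ R phi mphi mu setT _ measurableT mg;
  last by move=> x _; exact: f0.
pose nu : {measure set (measurableTypeR R) -> \bar R} := pushforward mu phi.
apply: (@eq_measure_integral _ _ _ _ mu (nu mphi)) => A mA _.
exact: lebesgue_measureN.
Qed.

End affine.

Section convolution.
Context {R : realType}.
Local Notation mu := (@lebesgue_measure R).
Local Open Scope ereal_scope.
Implicit Types f g k : R -> \bar R.

(** With nonnegative values in [\bar R], every convolution exists and Tonelli applies; integrability
    need not be carried along. *)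
Definition nnm f := measurable_fun [set: R] f /\ forall x, 0 <= f x.

(** The integral runs over the whole line; one-sided convolutions arise from factors vanishing at
    nonpositive arguments. *)
Definition conv f g (t : R) : \bar R := \int[mu]_s (f s * g (t - s)%R).

Lemma nnm_conv_integrand f g : nnm f -> nnm g ->
  measurable_fun [set: R * R] (fun z : R * R => f z.1 * g (z.2 - z.1)%R).
Proof.
move=> [mf _] [mg _]; apply: emeasurable_funM; first exact: measurableT_comp.
by apply: measurableT_comp => //; exact: measurable_funB.
Qed.

Lemma nnm_section f g t : nnm f -> nnm g -> nnm (fun s => f s * g (t - s)%R).
Proof.
move=> [mf f0] [mg g0]; split; last by move=> s; exact: mule_ge0.
apply: emeasurable_funM => //; apply: measurableT_comp => //.
exact: measurable_funB.
Qed.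

Lemma nnm_conv f g : nnm f -> nnm g -> nnm (conv f g).
Proof.
move=> Hf Hg; split; last first.
  by move=> t; apply: integral_ge0 => s _; exact: (nnm_section t Hf Hg).2.
have := measurable_fun_fubini_tonelli_G (m1 := mu) _ (nnm_conv_integrand Hf Hg).
by apply=> z; apply: mule_ge0; [exact: Hf.2|exact: Hg.2].
Qed.

Lemma convC f g t : nnm f -> nnm g -> conv f g t = conv g f t.
Proof.
move=> Hf Hg; rewrite /conv -(@ge0_integral_reflect _ _ t);
  [|exact: (nnm_section t Hf Hg).1|exact: (nnm_section t Hf Hg).2].
by apply: eq_integral => s _; rewrite subKr muleC.
Qed.

(** Shifting the inner variable by [s] turns the left side into the double integral of
    [f s * g (r - s) * k (t - r)]; Tonelli then exchanges the integrations. *)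
Lemma convA f g k t : nnm f -> nnm g -> nnm k ->
  conv f (conv g k) t = conv (conv f g) k t.
Proof.
move=> Hf Hg Hk.
pose F (z : R * R) := f z.1 * g (z.2 - z.1)%R * k (t - z.2)%R.
have mF : measurable_fun setT F.
  apply: emeasurable_funM; first exact: nnm_conv_integrand.
  by apply: measurableT_comp; [exact: Hk.1|exact: measurable_funB].
have F0 z : 0 <= F z.
  by apply: mule_ge0; [apply: mule_ge0; [exact: Hf.2|exact: Hg.2]|exact: Hk.2].
transitivity (\int[mu]_s \int[mu]_r F (s, r)).
  apply: eq_integral => s _; rewrite {1}/conv.
  have Hs := nnm_section (t - s) Hg Hk.
  rewrite -ge0_integralZl//; [|exact: Hs.1|by move=> x _; exact: Hs.2|exact: Hf.2].
  rewrite -(@ge0_integral_shift _ (fun r => f s * (g r * k (t - s - r)%R)) s);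
    last 2 first.
  - by apply: emeasurable_funM => //; exact: Hs.1.
  - by move=> x; apply: mule_ge0; [exact: Hf.2|exact: Hs.2].
  apply: eq_integral => r _; rewrite /F/= muleA; congr (_ * k _).
  by rewrite opprB addrA subrK.
rewrite (fubini_tonelli (m1 := mu) (m2 := mu) F mF F0); apply: eq_integral => r _.
have Hr := nnm_section r Hf Hg.
rewrite /F/= ge0_integralZr//; [exact: Hr.1|by move=> x _; exact: Hr.2|exact: Hk.2].
Qed.

Lemma nnmZ (a : R) f : (0 <= a)%R -> nnm f -> nnm (fun x => a%:E * f x).
Proof.
move=> a0 [mf f0]; split; first exact: emeasurable_funM.
by move=> x; rewrite mule_ge0.
Qed.

Lemma convZr (a : R) f g t : (0 <= a)%R -> nnm f -> nnm g ->
  conv f (fun x => a%:E * g x) t = a%:E * conv f g t.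
Proof.
move=> a0 Hf Hg; have [m1 p1] := nnm_section t Hf Hg.
rewrite /conv -ge0_integralZl//.
by apply: eq_integral => s _; rewrite muleCA.
Qed.

Lemma convZl (a : R) f g t : (0 <= a)%R -> nnm f -> nnm g ->
  conv (fun x => a%:E * f x) g t = a%:E * conv f g t.
Proof.
move=> a0 Hf Hg; rewrite (convC _ (nnmZ a0 Hf) Hg) convZr//.
by rewrite (convC _ Hg Hf).
Qed.

Lemma le_conv f g f' g' t : nnm f -> nnm g -> nnm f' -> nnm g' ->
  (forall s, f s * g (t - s)%R <= f' s * g' (t - s)%R) ->
  conv f g t <= conv f' g' t.
Proof.
move=> Hf Hg Hf' Hg' H; apply: ge0_le_integral => //.
- by move=> s _; exact: (nnm_section t Hf Hg).2.
- exact: (nnm_section t Hf Hg).1.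
- exact: (nnm_section t Hf' Hg').1.
Qed.

(** Increments of primitives are compared in this form, with sums on both sides, since differences
    are unsafe in [\bar R]. *)
Lemma le_conv2 f1 g1 f2 g2 f3 g3 f4 g4 t1 t2 t3 t4 :
  nnm f1 -> nnm g1 -> nnm f2 -> nnm g2 -> nnm f3 -> nnm g3 -> nnm f4 -> nnm g4 ->
  (forall s, f1 s * g1 (t1 - s)%R + f2 s * g2 (t2 - s)%R <=
             f3 s * g3 (t3 - s)%R + f4 s * g4 (t4 - s)%R) ->
  conv f1 g1 t1 + conv f2 g2 t2 <= conv f3 g3 t3 + conv f4 g4 t4.
Proof.
move=> Hf1 Hg1 Hf2 Hg2 Hf3 Hg3 Hf4 Hg4 H.
have [m1 p1] := nnm_section t1 Hf1 Hg1; have [m2 p2] := nnm_section t2 Hf2 Hg2.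
have [m3 p3] := nnm_section t3 Hf3 Hg3; have [m4 p4] := nnm_section t4 Hf4 Hg4.
rewrite /conv -(ge0_integralD mu measurableT (fun s _ => p1 s) m1 (fun s _ => p2 s) m2).
rewrite -(ge0_integralD mu measurableT (fun s _ => p3 s) m3 (fun s _ => p4 s) m4).
apply: ge0_le_integral => //.
- by move=> s _; exact: adde_ge0.
- exact: emeasurable_funD.
- exact: emeasurable_funD.
Qed.

End convolution.

Section thinning_algebra.
Context {R : comPzRingType}.

(** Mark each visit [x j = 1] independently with probability [b]: the product is the probability of
    no mark, and [b] times the term [l] that of a last mark at [l]. Algebraically, the tail products
    telescope. *)
Lemma prod_renewal (b : R) (x : nat -> R) m :
  \prod_(0 <= j < m) (1 - b * x j) +
    b * \sum_(0 <= l < m) x l * \prod_(l.+1 <= j < m) (1 - b * x j) = 1.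
Proof.
elim: m => [|m IH]; first by rewrite !big_geq// mulr0 addr0.
have -> : \sum_(0 <= l < m.+1) x l * \prod_(l.+1 <= j < m.+1) (1 - b * x j) =
    (\sum_(0 <= l < m) x l * \prod_(l.+1 <= j < m) (1 - b * x j)) *
      (1 - b * x m) + x m.
  rewrite big_nat_recr//= [in X in _ + X]big_geq// mulr1 big_distrl/=.
  congr (_ + _); apply: eq_big_nat => l /andP[_ lm].
  by rewrite big_nat_recr//= mulrA.
rewrite big_nat_recr//= -[RHS]addr0 -[X in _ = X + _]IH; set p := \prod_(_ <= _ < _) _.
set s := \sum_(_ <= _ < _) _.
move: IH; rewrite -/p -/s => IH.
have -> : p = 1 - b * s by rewrite -IH addrK.
ring.
Qed.

End thinning_algebra.

(** * Expectations of bounded random variables *)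

Section bounded_expectation.
Context {R : realType} {d : measure_display} {T : measurableType d}.
Variable M : probability T R.

(** Stable under sums and products and integrable under every probability, so linearity of the
    expectation comes without side computations. *)
Definition bmf (f : T -> R) :=
  measurable_fun setT f /\ exists C : R, forall w, `|f w| <= C.

Lemma bmf_integrable f : bmf f -> M.-integrable setT (EFin \o f).
Proof.
move=> [mf [C fC]]; apply: measurable_bounded_integrable => //.
  by apply: le_lt_trans (ltry 1); exact: probability_le1.
exists C; split; first exact: num_real.
by move=> x Cx w _; exact: le_trans (fC w) (ltW Cx).
Qed.

Lemma bmfD f g : bmf f -> bmf g -> bmf (fun w => f w + g w).
Proof.
move=> [mf [C fC]] [mg [D gD]]; split; first exact: measurable_funD.
by exists (C + D) => w; rewrite (le_trans (ler_normD _ _))// lerD.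
Qed.

Lemma bmfM f g : bmf f -> bmf g -> bmf (fun w => f w * g w).
Proof.
move=> [mf [C fC]] [mg [D gD]]; split; first exact: measurable_funM.
by exists (C * D) => w; rewrite normrM ler_pM.
Qed.

Lemma bmf_cst a : bmf (fun=> a).
Proof. by split => //; exists `|a|. Qed.

Lemma bmf_indic (A : set T) : measurable A -> bmf (\1_A).
Proof.
move=> mA; split; first exact: measurable_indic.
by exists 1 => w; rewrite indicE; case: (w \in A); rewrite ?normr1// normr0.
Qed.

Lemma bmf_sum (F : nat -> T -> R) m n : (forall l, bmf (F l)) ->
  bmf (fun w => \sum_(m <= l < n) F l w).
Proof.
move=> HF; elim: (index_iota m n) => [|l s IH].
  by have := bmf_cst 0; congr bmf; apply/funext => w; rewrite big_nil.
have := bmfD (HF l) IH; congr bmf; apply/funext => w; by rewrite big_cons.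
Qed.

Lemma bmf_prod (F : nat -> T -> R) m n : (forall l, bmf (F l)) ->
  bmf (fun w => \prod_(m <= l < n) F l w).
Proof.
move=> HF; elim: (index_iota m n) => [|l s IH].
  by have := bmf_cst 1; congr bmf; apply/funext => w; rewrite big_nil.
have := bmfM (HF l) IH; congr bmf; apply/funext => w; by rewrite big_cons.
Qed.

Lemma bexpD f g : bmf f -> bmf g ->
  \int[M]_w (f w + g w) = \int[M]_w f w + \int[M]_w g w.
Proof. by move=> /bmf_integrable ? /bmf_integrable ?; rewrite RintegralD. Qed.

Lemma bexpZ a f : bmf f -> \int[M]_w (a * f w) = a * \int[M]_w f w.
Proof. by move=> /bmf_integrable ?; rewrite RintegralZl. Qed.

Lemma bexp_sum (F : nat -> T -> R) n : (forall l, bmf (F l)) ->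
  \int[M]_w (\sum_(0 <= l < n) F l w) = \sum_(0 <= l < n) \int[M]_w F l w.
Proof.
move=> HF; elim: n => [|n IH].
  rewrite big_geq//; under eq_Rintegral do rewrite big_geq//.
  by rewrite Rintegral_cst// mul0r.
rewrite big_nat_recr//= -IH -bexpD//; last exact: bmf_sum.
by apply: eq_Rintegral => w _; rewrite big_nat_recr.
Qed.

Lemma bexp_indic (A : set T) : measurable A ->
  \int[M]_w (\1_A w : R) = fine (M A).
Proof. by move=> mA; rewrite /Rintegral integral_indic// setIT. Qed.

End bounded_expectation.

(** * The discrete skeleton *)

Section skeleton.
Context {R : realType} {d : measure_display} {Omega : measurableType d}
  {S : countType}.
Variables (P : S -> probability Omega R) (X : R -> Omega -> S) (i : S).
Hypothesis HX : markov_process P X.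

Definition visit (t : R) (w : Omega) : R := \1_[set w | X t w = i] w.

Definition return_prob (t : R) : R := transition_prob P X t i i.

Lemma bmf_visit t : 0 <= t -> bmf (visit t).
Proof. by move=> t0; apply: bmf_indic; exact: (markov_measurable HX). Qed.

(* With [b = 1 - exp (kappa * del)] this is [exp (kappa * L)], [L] being the
   Riemann sum of mesh [del] of the occupation time of [i] after time [s]. *)
Definition survival (del b s : R) (m : nat) (w : Omega) : R :=
  \prod_(0 <= j < m) (1 - b * visit (s + j.+1%:R * del) w).

Lemma bmf_survival del b s m : 0 <= del -> 0 <= s -> bmf (survival del b s m).
Proof.
move=> del0 s0; apply: bmf_prod => j.
have -> : (fun w => 1 - b * visit (s + j.+1%:R * del) w) =
    (fun w => 1 + (- b) * visit (s + j.+1%:R * del) w).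
  by apply/funext => w; rewrite mulNr.
apply: bmfD; first exact: bmf_cst.
by apply: bmfM; [exact: bmf_cst|apply: bmf_visit; rewrite addr_ge0// mulr_ge0].
Qed.

(** The grid starts one step after [s], so [survival] has no factor at time [s] itself. Hence the
    factors after a visit at [s + l.+1%:R * del] again form a [survival] started there, with
    [m - l.+1] steps left. *)
Lemma survival_renewal del b s m w :
  survival del b s m w + b * \sum_(0 <= l < m) visit (s + l.+1%:R * del) w *
    survival del b (s + l.+1%:R * del) (m - l.+1) w = 1.
Proof.
rewrite -[RHS](prod_renewal b (fun j => visit (s + j.+1%:R * del) w) m).
congr (_ + b * _); apply: eq_big_nat => l /andP[_ lm]; congr (_ * _).
rewrite /survival -[in RHS](add0n l.+1) big_addn.
apply: eq_big_nat => j _; congr (1 - b * visit _ w).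
by rewrite -addrA -mulrDl -natrD (addnC l.+1) addSn.
Qed.

Definition past_at (n : nat) (t : nat -> R) : set Omega :=
  [set w | forall m, (m <= n)%N -> X (t m) w = i].

Definition extend (n : nat) (t : nat -> R) (v : R) (m : nat) : R :=
  if (m <= n)%N then t m else v.

Lemma past_at_extend n t v :
  past_at n.+1 (extend n t v) = past_at n t `&` [set w | X v w = i].
Proof.
apply/seteqP; split => [w H|w [H1 H2] m]/=.
- split => [m mn|].
    by have := H m (leqW mn); rewrite /extend mn.
  by have := H n.+1 (leqnn _); rewrite /extend ltnn.
- by rewrite /extend leq_eqVlt ltnS; case: leqP => [mn _|_ _]; [exact: H1|exact: H2].
Qed.

Definition admissible (n : nat) (t : nat -> R) :=
  0 <= t 0%N /\ forall m, (m < n)%N -> t m <= t m.+1.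

Lemma admissible_ge0 n t : admissible n t -> forall m, (m <= n)%N -> 0 <= t m.
Proof.
move=> [t0 tm]; elim=> // m IH mn; apply: le_trans (tm _ mn).
exact: IH (ltnW mn).
Qed.

Lemma admissible_extend n t v : admissible n t -> t n <= v ->
  admissible n.+1 (extend n t v).
Proof.
move=> [t0 tm] tv; split => // m; rewrite ltnS /extend => mn; rewrite mn.
by case: ltnP => [|nm]; [exact: tm|have -> : m = n by apply/eqP; rewrite eqn_leq mn].
Qed.

Lemma measurable_past_at n t : admissible n t -> measurable (past_at n t).
Proof.
move=> tn; have -> : past_at n t = \bigcap_(m in [set m | (m <= n)%N]) [set w | X (t m) w = i].
  by apply/seteqP; split.
apply: bigcap_measurable; first by exists 0%N.
by move=> m /= mn; apply: (markov_measurable HX _ (admissible_ge0 tn mn)).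
Qed.

Lemma past_at_extend_prob n t u : admissible n t -> 0 <= u ->
  fine (P i (past_at n.+1 (extend n t (t n + u)))) =
    fine (P i (past_at n t)) * return_prob u.
Proof.
move=> [t0 tm] u0; rewrite past_at_extend.
have := markov_property HX i (fun=> i) i t0 tm u0; rewrite /= => ->.
by rewrite fineM//; apply: fin_num_measure;
  [exact: measurable_past_at|exact: (markov_measurable HX)].
Qed.

Lemma past_at_start : P i (past_at 0 (fun=> 0)) = 1%E.
Proof.
rewrite -(markov_start HX i); congr (P i _).
by apply/seteqP; split => [w /(_ 0%N (leqnn _))//|w Xw m' _].
Qed.

Definition mean_survival del b m : R := \int[P i]_w survival del b 0 m w.

(* Each term of [survival_renewal] only adds a visit to [i] to the past, so
   pasts staying at [i] suffice and no sum over [S] appears. *)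
Lemma past_survival_step del b n t m : 0 <= del -> admissible n t ->
  (forall l, (l < m)%N -> forall n' t', admissible n' t' ->
    \int[P i]_w (\1_(past_at n' t') w * survival del b (t' n') (m - l.+1) w) =
    fine (P i (past_at n' t')) * mean_survival del b (m - l.+1)) ->
  \int[P i]_w (\1_(past_at n t) w * survival del b (t n) m w) =
  fine (P i (past_at n t)) *
    (1 - b * \sum_(0 <= l < m) return_prob (l.+1%:R * del) *
      mean_survival del b (m - l.+1)).
Proof.
move=> del0 tn IH.
have tn0 : 0 <= t n by exact: admissible_ge0 tn _ _.
pose B l := extend n t (t n + l.+1%:R * del).
have Bn l : admissible n.+1 (B l).
  by apply: admissible_extend => //; rewrite lerDl mulr_ge0.
have Bl l : B l n.+1 = t n + l.+1%:R * del by rewrite /B /extend ltnn.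
have sB l : bmf (fun w => \1_(past_at n.+1 (B l)) w *
    survival del b (t n + l.+1%:R * del) (m - l.+1) w).
  apply: bmfM; first exact/bmf_indic/measurable_past_at.
  by apply: bmf_survival => //; rewrite addr_ge0// mulr_ge0.
have s0 : bmf (fun w => \1_(past_at n t) w * survival del b (t n) m w).
  apply: bmfM; first exact/bmf_indic/measurable_past_at.
  exact: bmf_survival.
have E : fine (P i (past_at n t)) =
    \int[P i]_w (\1_(past_at n t) w * survival del b (t n) m w) +
    b * \sum_(0 <= l < m) \int[P i]_w (\1_(past_at n.+1 (B l)) w *
      survival del b (t n + l.+1%:R * del) (m - l.+1) w).
  rewrite -bexp_sum// -bexpZ; last exact: bmf_sum.
  rewrite -bexpD//; last by apply: bmfM; [exact: bmf_cst|exact: bmf_sum].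
  rewrite -bexp_indic; last exact: measurable_past_at.
  apply: eq_Rintegral => w _.
  rewrite -[LHS]mulr1 -[X in _ * X = _](survival_renewal del b (t n) m w) mulrDr mulrCA.
  congr (_ + b * _); rewrite big_distrr/=; apply: eq_bigr => l _.
  by rewrite mulrA past_at_extend indicI.
rewrite mulrBr mulr1 [X in X - _]E -addrA; apply/esym.
rewrite -[RHS]addr0; congr (_ + _); apply/eqP; rewrite subr_eq0; apply/eqP.
rewrite mulrCA; congr (b * _); rewrite big_distrr/=; apply: eq_big_nat => l /andP[_ lm].
rewrite mulrA -past_at_extend_prob// ?mulr_ge0//.
by have := IH l lm _ _ (Bn l); rewrite Bl.
Qed.

(** Strong induction on the number of steps left: [past_survival_step] gives the probability of the
    past times a bracket that does not depend on the past. For the past [X 0 = i], of probability 1,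
    the same formula identifies this bracket with [mean_survival del b m]. *)
Lemma past_survival del b m n t : 0 <= del -> admissible n t ->
  \int[P i]_w (\1_(past_at n t) w * survival del b (t n) m w) =
  fine (P i (past_at n t)) * mean_survival del b m.
Proof.
move=> del0; elim/ltn_ind: m n t => m IH n t tn.
have step n' t' (tn' : admissible n' t') := past_survival_step del0 tn'
  (fun l lm n'' t'' => IH (m - l.+1)%N
     (ltac:(by rewrite ltn_subrL (leq_ltn_trans _ lm))) n'' t'').
rewrite step//; congr (_ * _); rewrite -[LHS]mul1r.
have t0 : admissible 0 (fun=> 0 : R) by split.
have P0 := past_at_start.
rewrite -[X in X * _]/(fine 1) -P0 -step//.
rewrite /mean_survival /Rintegral; congr fine.
have m0 := measurable_past_at t0.
apply: ae_eq_integral => //.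
- by apply/measurable_EFinP/measurable_funM;
    [exact: measurable_indic|exact: (bmf_survival _ _ _ _).1].
- by apply/measurable_EFinP; exact: (bmf_survival _ _ _ _).1.
have N0 : (P i).-negligible (~` past_at 0 (fun=> 0)).
  apply/negligibleP; first exact: measurableC.
  by apply: etrans (probability_setC (P i) m0) _; rewrite P0 subee.
apply: negligibleS N0 => w /= wn Hw; apply: wn => _.
by rewrite indicE mem_set// mul1r.
Qed.

Lemma mean_survival_renewal del b m : 0 <= del ->
  mean_survival del b m + b * \sum_(0 <= l < m) return_prob (l.+1%:R * del) *
    mean_survival del b (m - l.+1) = 1.
Proof.
move=> del0.
have t0 : admissible 0 (fun=> 0 : R) by split.
have P0 := past_at_start.
have := past_survival b m del0 t0.
have := past_survival_step del0 t0
  (fun l lm n'' t'' => @past_survival del b (m - l.+1)%N n'' t'' del0).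
by rewrite P0 /= !mul1r => -> <-; rewrite subrK.
Qed.

End skeleton.

(** * From the skeleton to continuous time *)

Section step_functions.
Context {R : realType}.
Local Notation mu := (@lebesgue_measure R).

Lemma bounded_cvg d (T : measurableType d) (M : {measure set T -> \bar R})
    (D : set T) (f_ : nat -> T -> R) (f : T -> R) (C : R) :
  measurable D -> (M D < +oo)%E ->
  (forall n, measurable_fun D (f_ n)) -> measurable_fun D f ->
  (forall n x, D x -> `|f_ n x| <= C) ->
  {ae M, forall x, D x -> f_ n x @[n --> \oo] --> f x} ->
  \int[M]_(x in D) f_ n x @[n --> \oo] --> \int[M]_(x in D) f x.
Proof.
move=> mD MD mf_ mf fC ff.
have iC : M.-integrable D (EFin \o cst C).
  apply: measurable_bounded_integrable => //.
  exists `|C|; split; first exact: num_real.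
  by move=> x Cx w _; exact: ltW.
have [] := @dominated_convergence _ _ R M D mD (fun n => EFin \o f_ n) (EFin \o f)
   (EFin \o cst C).
- by move=> n; exact/measurable_EFinP.
- exact/measurable_EFinP.
- apply: filterS ff => x H Dx; apply: cvg_EFin; first exact: nearW.
  exact: H.
- exact: iC.
- by apply/aeW => x n Dx; rewrite /= lee_fin; exact: fC.
move=> fi _ H; apply: fine_cvg; move: H; rewrite fineK//.
exact: integrable_fin_num.
Qed.

(* Strictly to the right of [s], so that right continuity applies. *)
Definition next_grid (del s : R) : R := (Num.truncn (s / del)).+1%:R * del.

Lemma next_grid_gt del s : 0 < del -> s < next_grid del s.
Proof. by move=> d0; rewrite /next_grid -ltr_pdivrMr// truncnS_gt. Qed.

Lemma next_grid_le del s : 0 < del -> 0 <= s -> next_grid del s <= s + del.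
Proof.
move=> d0 s0; rewrite /next_grid -natr1 mulrDl mul1r lerD2r -ler_pdivlMr//.
by rewrite truncn_le divr_ge0// ltW.
Qed.

(** As [F] is arbitrary, preimages are written as countable unions of level sets of [Num.truncn]. *)
Lemma measurable_truncn (F : nat -> R) (del : R) :
  measurable_fun [set: R] (fun s => F (Num.truncn (s / del))).
Proof.
have mt : measurable_fun [set: R] (fun s : R => (Num.truncn s)%:R : R).
  by apply: nondecreasing_measurable => // x y xy; rewrite ler_nat; exact: le_truncn.
have mF : measurable_fun [set: R] (fun s : R => F (Num.truncn s)).
  move=> _ Y mY; rewrite setTI.
  have -> : (fun s : R => F (Num.truncn s)) @^-1` Y = \bigcup_(n in [set n | Y (F n)])
      ((fun s : R => (Num.truncn s)%:R : R) @^-1` [set n%:R]).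
    apply/seteqP; split => [s /= Ys|s [n /= Yn]]; first by exists (Num.truncn s).
    by move=> /eqP; rewrite eqr_nat => /eqP ->.
  by apply: bigcup_measurable => n _; rewrite -[X in measurable X]setTI; exact: mt.
exact: (measurableT_comp mF (mulrr_measurable _)).
Qed.

Lemma lebesgue_itv_lty (b1 b2 : bool) (a b : R) :
  (mu [set` Interval (BSide b1 a) (BSide b2 b)] < +oo)%E.
Proof. by rewrite lebesgue_measure_itv/=; case: ifP; rewrite ?ltry// -EFinD ltry. Qed.

Lemma integrable_step (F : nat -> R) (del C a b : R) : (forall l, `|F l| <= C) ->
  mu.-integrable `[a, b[ (EFin \o (fun s => F (Num.truncn (s / del)))).
Proof.
move=> FC; apply: measurable_bounded_integrable => //.
- exact: lebesgue_itv_lty.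
- exact: measurable_funTS (measurable_truncn _ _).
exists C; split; first exact: num_real.
by move=> x Cx w _; exact: le_trans (FC _) (ltW Cx).
Qed.

(** A sum over the grid is the integral of a step function; limits of Riemann sums thereby become
    cases of dominated convergence. *)
Lemma sum_step (F : nat -> R) (del C : R) m : 0 < del -> (forall l, `|F l| <= C) ->
  del * (\sum_(0 <= l < m) F l) =
  \int[mu]_(s in `[0, m%:R * del[) F (Num.truncn (s / del)).
Proof.
move=> d0 FC; elim: m => [|m IH].
  by rewrite big_geq// mulr0 mul0r set_itvco0 Rintegral_set0.
have md : m%:R * del < m.+1%:R * del by rewrite ltr_pM2r// ltr_nat.
have split : `[0, m.+1%:R * del[%classic =
    `[0, m%:R * del[%classic `|` `[m%:R * del, m.+1%:R * del[%classic :> set R.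
  by apply: itv_bndbnd_setU; rewrite bnd_simp; [rewrite mulr_ge0// ltW|exact: ltW].
rewrite split Rintegral_setU//; last 2 first.
- by rewrite -split; exact: integrable_step FC.
- apply/disj_setPS => s [] /=; rewrite !in_itv/= => /andP[_ sm] /andP[ms _].
  by move: (lt_le_trans sm ms); rewrite ltxx.
rewrite -IH big_nat_recr//= mulrDr; congr (_ + _).
transitivity (\int[mu]_(s in `[m%:R * del, m.+1%:R * del[) F m).
  have E : mu `[m%:R * del, m.+1%:R * del[ = del%:E.
    rewrite lebesgue_measure_itv/= lte_fin md -EFinD/=.
    by rewrite -mulrBl -natr1 addrAC subrr add0r mul1r.
  by rewrite Rintegral_cst// [X in fine X](_ : _ = del%:E)//= mulrC.
apply: eq_Rintegral => s; rewrite inE/= in_itv/= => /andP[ms sm].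
by rewrite (@truncn_def _ _ m)// ler_pdivlMr// ms ltr_pdivrMr.
Qed.

Lemma right_cvg_grid (T : topologicalType) (f : R -> T) (del_ : nat -> R) s :
  (forall n, 0 < del_ n) -> 0 <= s -> del_ n @[n --> \oo] --> (0 : R) ->
  f y @[y --> s^'+] --> f s ->
  f (next_grid (del_ n) s) @[n --> \oo] --> f s.
Proof.
move=> d0 s0 d_0 fs A /fs [e /= e0 eA].
have : \forall n \near \oo, `|0 - del_ n| < e.
  by move/cvgr_dist_lt : d_0; apply.
apply: filterS => n; rewrite sub0r normrN gtr0_norm// => de.
apply: eA => /=; last exact: next_grid_gt.
have := next_grid_le (d0 n) s0; have := next_grid_gt s (d0 n).
by move=> h1 h2; rewrite distrC gtr0_norm ?subr_gt0// ltrBlDl (le_lt_trans h2)// ltrD2l.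
Qed.

Lemma divn_cvg0 (t : R) : t / n.+1%:R @[n --> \oo] --> (0 : R).
Proof.
rewrite -[X in _ --> X](mulr0 t); apply: cvgM; first exact: cvg_cst.
exact: cvg_harmonic.
Qed.

(** The value at the next grid point is a step function of [s], and by right continuity these step
    functions converge to [f] pointwise. *)
Lemma right_continuous_measurable (f : R -> R) :
  (forall s, 0 <= s -> f y @[y --> s^'+] --> f s) ->
  measurable_fun (`[0, +oo[%classic : set R) f.
Proof.
move=> rcf.
apply: (@measurable_fun_cvg _ _ _ _ (fun n s => f (next_grid (1 / n.+1%:R) s))).
  move=> n; apply: measurable_funTS.
  exact: (@measurable_truncn (fun l => f (l.+1%:R * (1 / n.+1%:R)))).
move=> s; rewrite /= in_itv/= andbT => s0.
apply: (@right_cvg_grid _ f (fun n => 1 / n.+1%:R)) => //; last exact: rcf.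
exact: divn_cvg0.
Qed.

End step_functions.

(** * Riemann sums of the occupation time *)

Section grid_limits.
Context {R : realType} {d : measure_display} {Omega : measurableType d}
  {S : countType}.
Variables (P : S -> probability Omega R) (X : R -> Omega -> S) (i : S).
Hypothesis HX : markov_process P X.
Local Notation mu := (@lebesgue_measure R).

Lemma visit_right_continuous w s : 0 <= s ->
  visit X i y w @[y --> s^'+] --> visit X i s w.
Proof.
move=> s0; apply: cvg_near_cst.
have := markov_right_continuous HX w s0.
apply: filterS => y Xy; rewrite /visit !indicE; congr (nat_of_bool _)%:R.
by apply/idP/idP; rewrite !inE /= Xy.
Qed.

Lemma visit01 s w : visit X i s w = 0 \/ visit X i s w = 1.
Proof. by rewrite /visit indicE; case: (_ \in _); [right|left]. Qed.

Lemma visit_ge0 s w : 0 <= visit X i s w.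
Proof. by case: (visit01 s w) => ->. Qed.

Lemma visit_norm_le1 s w : `|visit X i s w| <= 1.
Proof. by case: (visit01 s w) => ->; rewrite ?normr0// normr1. Qed.

Lemma return_probE s : 0 <= s ->
  return_prob P X i s = \int[P i]_w visit X i s w.
Proof. by move=> s0; rewrite bexp_indic//; exact: (markov_measurable HX). Qed.


Lemma return_prob01 s : 0 <= s -> 0 <= return_prob P X i s <= 1.
Proof.
move=> s0; rewrite /return_prob /transition_prob fine_ge0//=.
have mX := markov_measurable HX i s0.
by rewrite -lee_fin fineK ?fin_num_measure// probability_le1.
Qed.

(** Right continuity of the paths, integrated by bounded convergence. *)
Lemma return_prob_right_continuous_grid (del_ : nat -> R) s :
  (forall n, 0 < del_ n) -> 0 <= s -> del_ n @[n --> \oo] --> (0 : R) ->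
  return_prob P X i (next_grid (del_ n) s) @[n --> \oo] --> return_prob P X i s.
Proof.
move=> d0 s0 d_0; rewrite return_probE//.
have ng n : 0 <= next_grid (del_ n) s by rewrite (le_trans s0)// ltW// next_grid_gt.
under eq_fun do rewrite return_probE//.
apply: (@bounded_cvg _ _ _ _ _ _ _ 1) => //.
- by apply: le_lt_trans (ltry 1); exact: probability_le1.
- by move=> n; exact: (bmf_visit i HX (ng n)).1.
- exact: (bmf_visit i HX s0).1.
- by move=> n w _; exact: visit_norm_le1.
- apply/aeW => w _; apply: (@right_cvg_grid _ _ (fun s => visit X i s w)) => //.
  exact: visit_right_continuous.
Qed.

Lemma measurable_return_prob :
  measurable_fun (`[0, +oo[%classic : set R) (return_prob P X i).
Proof.
apply: (@measurable_fun_cvg _ _ _ _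
  (fun n s => return_prob P X i (next_grid (1 / n.+1%:R) s))).
  move=> n; apply: measurable_funTS.
  exact: (@measurable_truncn _ (fun l => return_prob P X i (l.+1%:R * (1 / n.+1%:R)))).
move=> s; rewrite /= in_itv/= andbT => s0.
apply: (@return_prob_right_continuous_grid (fun n => 1 / n.+1%:R)) => //.
exact: divn_cvg0.
Qed.

Lemma measurable_visit_path w (a : itv_bound R) : (BLeft 0 <= a)%O ->
  forall b, measurable_fun [set` Interval a b] (fun s => visit X i s w).
Proof.
move=> a0 b; have := right_continuous_measurable (@visit_right_continuous w).
apply: measurable_funS => //; apply: subset_itv => //.
exact: bound_lex1.
Qed.

Lemma integrable_visit_path w t :
  mu.-integrable `[0, t] (EFin \o (fun s => visit X i s w)).
Proof.
apply: measurable_bounded_integrable => //.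
- exact: lebesgue_itv_lty.
- exact: measurable_visit_path.
exists 1; split; first exact: num_real.
by move=> x Cx s _; exact: le_trans (visit_norm_le1 _ _) (ltW Cx).
Qed.

Lemma local_timeE t w :
  local_time X i t w = \int[mu]_(s in `[0, t]) visit X i s w.
Proof. by []. Qed.

Lemma local_time_ge0 t w : 0 <= local_time X i t w.
Proof. by apply: Rintegral_ge0 => s _; exact: visit_ge0. Qed.

Lemma le_local_time w : {homo (fun t => local_time X i t w) : s t / s <= t}.
Proof.
move=> s t st; rewrite !local_timeE -lee_fin /Rintegral !fineK.
- apply: ge0_subset_integral => //.
  + by apply/measurable_EFinP; exact: measurable_visit_path.
  + by move=> r _; rewrite lee_fin visit_ge0.
  + exact: subset_itvl.
- exact: integrable_fin_num (integrable_visit_path w t).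
- exact: integrable_fin_num (integrable_visit_path w s).
Qed.

(** The mesh is tied to [t] while the sum stops near [tau], because in the renewal equation all the
    times [tau = t - s] share one grid. *)
Lemma riemann_local_time (t tau : R) (m_ : nat -> nat) w : 0 < t -> 0 <= tau <= t ->
  (forall n, (m_ n <= n.+1)%N) ->
  (m_ n)%:R * (t / n.+1%:R) @[n --> \oo] --> tau ->
  (t / n.+1%:R) * \sum_(0 <= l < m_ n) visit X i (l.+1%:R * (t / n.+1%:R)) w
    @[n --> \oo] --> local_time X i tau w.
Proof.
move=> t0 /andP[tau0 taut] mn mtau.
have d0 n : 0 < t / n.+1%:R by rewrite divr_gt0.
have mt n : (m_ n)%:R * (t / n.+1%:R) <= t.
  by rewrite mulrCA ler_piMr// ?(ltW t0)// ler_pdivrMr// mul1r ler_nat.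
have E n := @sum_step _ (fun l => visit X i (l.+1%:R * (t / n.+1%:R)) w) _ 1 (m_ n)
  (d0 n) (fun l => visit_norm_le1 _ w).
rewrite local_timeE.
pose f_ n s : R := \1_(`[0%R, (m_ n)%:R * (t / n.+1%:R)[) s *
  visit X i (next_grid (t / n.+1%:R) s) w.
pose f s : R := \1_(`[0%R, tau]) s * visit X i s w.
have mind (A : set R) (g : R -> R) : A `<=` `[0, t] ->
    \int[mu]_(s in A) g s = \int[mu]_(s in `[0, t]) (\1_A s * g s).
  move=> At; rewrite -[in LHS](setIidr At) Rintegral_mkcondr; apply: eq_Rintegral => s _.
  by rewrite patchE indicE; case: ifP => _; rewrite ?mul1r ?mul0r.
have sub1 : `[0, tau] `<=` `[0, t].
  by move=> s /=; rewrite !in_itv/= => /andP[-> /le_trans]; exact.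
have sub2 n : `[0, (m_ n)%:R * (t / n.+1%:R)[ `<=` `[0, t].
  move=> s /=; rewrite !in_itv/= => /andP[-> /ltW/le_trans]; exact.
rewrite (mind _ _ sub1).
rewrite [X in X @ _ --> _](_ : _ = fun n => \int[mu]_(s in `[0, t]) f_ n s); last first.
  by apply/funext => n; rewrite E; exact: (mind _ _ (sub2 n)).
apply: (@bounded_cvg _ _ _ mu _ f_ f 1) => //.
- exact: lebesgue_itv_lty.
- move=> n; apply: measurable_funTS; apply: measurable_funM.
    exact: measurable_indic.
  exact: (@measurable_truncn _ (fun l => visit X i (l.+1%:R * (t / n.+1%:R)) w)).
- apply: measurable_funM; first exact: measurable_funTS (measurable_indic _).
  exact: measurable_visit_path.
- move=> n s _; rewrite normrM mulr_ile1 ?normr_ge0 ?visit_norm_le1//.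
  by rewrite indicE; case: (_ \in _); rewrite ?normr1 ?normr0.
(* The indicators of the summation intervals converge to that of [[0, tau]] at each [s] other than
   possibly [tau], and a point is negligible. *)
have Ntau : mu.-negligible [set tau].
  by apply/negligibleP => //; exact: lebesgue_measure_set1.
apply: negligibleS Ntau => s /= Hs; apply: contrapT => /eqP stau; apply: Hs => /=.
rewrite in_itv/= => /andP[s0 st].
have fcvg : visit X i (next_grid (t / n.+1%:R) s) w @[n --> \oo] --> visit X i s w.
  apply: (@right_cvg_grid _ _ (fun s => visit X i s w)) => //.
    exact: divn_cvg0.
  exact: visit_right_continuous.
apply: cvgM fcvg; apply: cvg_near_cst.
have [stau'|stau'|/eqP] := ltgtP s tau; last by rewrite (negbTE stau).
- have : \forall n \near \oo, s < (m_ n)%:R * (t / n.+1%:R).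
    exact: cvgr_gt mtau _ stau'.
  apply: filterS => n sn; rewrite !indicE !mem_set//= in_itv/= s0//=.
  exact: ltW.
- have : \forall n \near \oo, (m_ n)%:R * (t / n.+1%:R) < s.
    exact: cvgr_lt mtau _ stau'.
  apply: filterS => n sn; rewrite !indicE !memNset//= in_itv/= s0//=; apply/negP.
    by rewrite -ltNge.
  by rewrite -leNgt ltW.
Qed.

End grid_limits.

Lemma expR_difference_quotient (R : realType) (u : nat -> R) :
  (forall n, u n != 0) -> u n @[n --> \oo] --> (0 : R) ->
  (expR (u n) - 1) / u n @[n --> \oo] --> (1 : R).
Proof.
move=> u0 ucvg.
have D : h^-1 *: (expR (h *: 1 + 0) - expR 0) @[h --> 0^'] --> (1 : R).
  have [/= dE E1] := is_derive_expR (0 : R).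
  rewrite expR0 in E1; rewrite -[X in _ --> X]E1; exact: dE.
have : (fun h => h^-1 *: (expR (h *: 1 + 0) - expR 0)) (u n) @[n --> \oo] --> (1 : R).
  apply: (cvg_comp u _ _ D).
  move=> A /ucvg; rewrite /= => -[N _ HN]; exists N => // n /HN; apply.
  exact: u0.
have E n : (expR (u n) - 1) / u n = (u n)^-1 *: (expR (u n *: 1 + 0) - expR 0).
  by rewrite addr0 expR0 /GRing.scale /= mulr1 mulrC.
by rewrite (funext E).
Qed.

(** * The renewal equation in continuous time *)

Section renewal_equation.
Context {R : realType} {d : measure_display} {Omega : measurableType d}
  {S : countType}.
Variables (P : S -> probability Omega R) (X : R -> Omega -> S) (i : S).
Hypothesis HX : markov_process P X.
Local Notation mu := (@lebesgue_measure R).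

(** For [t > 0] the local time is a pointwise limit of Riemann sums, which are finite combinations
    of visit indicators; for [t <= 0] it vanishes. *)
Lemma measurable_local_time t : measurable_fun setT (local_time X i t).
Proof.
have [t0|t0] := leP t 0.
  have -> : local_time X i t = fun=> 0.
    apply/funext => w; rewrite local_timeE; move: t0.
    rewrite le_eqVlt => /orP[/eqP ->|t0]; first by rewrite set_itv1 Rintegral_set1.
    by rewrite set_itv_ge ?Rintegral_set0// bnd_simp -ltNge.
  exact: measurable_cst.
have d0 n : 0 < t / n.+1%:R by rewrite divr_gt0.
apply: (@measurable_fun_cvg _ _ _ _ (fun n w =>
  (t / n.+1%:R) * \sum_(0 <= l < n.+1) visit X i (l.+1%:R * (t / n.+1%:R)) w)).
  move=> n; apply: measurable_funM => //; apply: measurable_sum => l.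
  by apply: (bmf_visit i HX _).1; rewrite mulr_ge0// ltW.
move=> w _; apply: (riemann_local_time HX (m_ := fun n => n.+1)) => //.
  by rewrite (ltW t0) lexx.
by under eq_fun do rewrite mulrCA divff// mulr1; exact: cvg_cst.
Qed.

Variable kappa : R.
Hypothesis kappa0 : kappa < 0.

Definition occupation_transform (t : R) : R :=
  \int[P i]_w expR (kappa * local_time X i t w).

Local Notation h := occupation_transform.

Lemma bmf_exp_local_time t : bmf (fun w => expR (kappa * local_time X i t w)).
Proof.
split.
  apply: measurableT_comp => //; apply: measurable_funM => //.
  exact: measurable_local_time.
exists 1 => w; rewrite ger0_norm ?expR_ge0// -[leRHS]expR0 ler_expR.
by rewrite nmulr_rle0// local_time_ge0.
Qed.

Lemma le_bexp (M : probability Omega R) (f g : Omega -> R) : bmf f -> bmf g ->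
  (forall w, f w <= g w) -> \int[M]_w f w <= \int[M]_w g w.
Proof.
by move=> ? ? fg; apply: le_Rintegral => //; exact: bmf_integrable.
Qed.

Lemma bexp_cst (M : probability Omega R) (a : R) : \int[M]_w a = a.
Proof.
rewrite Rintegral_cst// [X in fine X](_ : _ = 1%E); first by rewrite mulr1.
exact: probability_setT.
Qed.

Lemma occupation_transform01 t : 0 <= h t <= 1.
Proof.
apply/andP; split; first by apply: Rintegral_ge0 => w _; exact: expR_ge0.
rewrite -[leRHS](bexp_cst (P i)); apply: le_bexp.
- exact: bmf_exp_local_time.
- exact: bmf_cst.
- by move=> w; rewrite -[leRHS]expR0 ler_expR nmulr_rle0// local_time_ge0.
Qed.

Lemma occupation_transform_nonincreasing : {homo h : s t / s <= t >-> t <= s}.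
Proof.
move=> s t st; apply: le_bexp; [exact: bmf_exp_local_time..|] => w.
by rewrite ler_expR ler_nM2l//; exact: (le_local_time i HX).
Qed.

(** A visit is 0 or 1, and at both values [x] one has [1 - b x = exp (kappa del x)] for
    [b = 1 - exp (kappa del)]. *)
Lemma survival_exp del m w :
  survival X i del (1 - expR (kappa * del)) 0 m w =
  expR (kappa * (del * \sum_(0 <= l < m) visit X i (l.+1%:R * del) w)).
Proof.
rewrite /survival; elim: m => [|m IH].
  by rewrite !big_geq// !mulr0 expR0.
rewrite !big_nat_recr//= IH [in RHS]mulrDr [in RHS]mulrDr expRD; congr (_ * _).
rewrite add0r; case: (visit01 X i (m.+1%:R * del) w) => ->.
  by rewrite !mulr0 subr0 expR0.
by rewrite !mulr1 subKr.
Qed.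

Lemma mean_survival_cvg (t tau : R) (m_ : nat -> nat) : 0 < t -> 0 <= tau <= t ->
  (forall n, (m_ n <= n.+1)%N) ->
  (m_ n)%:R * (t / n.+1%:R) @[n --> \oo] --> tau ->
  mean_survival P X i (t / n.+1%:R) (1 - expR (kappa * (t / n.+1%:R))) (m_ n)
    @[n --> \oo] --> h tau.
Proof.
move=> t0 taut mn mtau.
have d0 n : 0 < t / n.+1%:R by rewrite divr_gt0.
apply: (@bounded_cvg _ _ _ _ _ _ _ 1) => //.
- by apply: le_lt_trans (ltry 1); exact: probability_le1.
- by move=> n; exact: (bmf_survival i HX _ _ (ltW (d0 n)) (lexx 0)).1.
- exact: (bmf_exp_local_time tau).1.
- move=> n w _; rewrite survival_exp ger0_norm ?expR_ge0// -[leRHS]expR0 ler_expR.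
  rewrite nmulr_rle0//; apply: mulr_ge0; first exact: ltW (d0 n).
  by apply: sumr_ge0 => l _; exact: visit_ge0.
- apply/aeW => w _; under eq_fun do rewrite survival_exp.
  apply: (continuous_cvg _ (@continuous_expR R _)).
  apply: cvgM; first exact: cvg_cst.
  exact: (riemann_local_time HX).
Qed.

Lemma mean_survival01 del m : 0 < del ->
  0 <= mean_survival P X i del (1 - expR (kappa * del)) m <= 1.
Proof.
move=> d0; rewrite /mean_survival; apply/andP; split.
  by apply: Rintegral_ge0 => w _; rewrite survival_exp expR_ge0.
rewrite -[leRHS](bexp_cst (P i)); apply: le_bexp.
- exact: (bmf_survival i HX _ _ (ltW d0) (lexx 0)).
- exact: bmf_cst.
- move=> w; rewrite survival_exp -[leRHS]expR0 ler_expR nmulr_rle0//.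
  by apply: mulr_ge0; [exact: ltW d0|apply: sumr_ge0 => l _; exact: visit_ge0].
Qed.

Lemma renewal_equation t : 0 < t ->
  h t - kappa * \int[mu]_(s in `[0, t[) (return_prob P X i s * h (t - s)) = 1.
Proof.
move=> t0.
pose del n : R := t / n.+1%:R.
have d0 n : 0 < del n by rewrite divr_gt0.
pose b n := 1 - expR (kappa * del n).
pose u n m := mean_survival P X i (del n) (b n) m.
(* The grid has [n.+1] steps, so [n.+1 - l.+1 = n - l] of them remain after a visit at the grid
   point [l.+1]. *)
pose F n l := return_prob P X i (l.+1%:R * del n) * u n (n - l)%N.
have F1 n l : `|F n l| <= 1.
  have /andP[p0 p1] : 0 <= return_prob P X i (l.+1%:R * del n) <= 1.
    by apply: (return_prob01 i HX) => //; rewrite mulr_ge0// ltW.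
  have /andP[u0 u1] := mean_survival01 (n - l)%N (d0 n).
  by rewrite ger0_norm ?mulr_ge0// mulr_ile1.
have E n : u n n.+1 + b n / del n * \int[mu]_(s in `[0, t[) F n (Num.truncn (s / del n)) = 1.
  rewrite -(mean_survival_renewal i HX (b n) n.+1 (ltW (d0 n))); congr (_ + _).
  have nt : n.+1%:R * del n = t by rewrite /del mulrCA divff// mulr1.
  have := sum_step n.+1 (d0 n) (F1 n); rewrite nt => <-.
  by rewrite mulrA divfK ?gt_eqF.
have dcvg : del n @[n --> \oo] --> (0 : R) by exact: divn_cvg0.
have ucvg : u n n.+1 @[n --> \oo] --> h t.
  apply: (@mean_survival_cvg t t (fun n => n.+1)) => //.
    by rewrite (ltW t0) lexx.
  by under eq_fun do rewrite mulrCA divff// mulr1; exact: cvg_cst.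
(* The quotient is [- kappa] times the difference quotient of [expR] at 0 with increment
   [kappa * del n]. *)
have bcvg : b n / del n @[n --> \oo] --> - kappa.
  have kd n : kappa * del n != 0 by rewrite mulf_neq0// ?(lt_eqF kappa0)// (gt_eqF (d0 n)).
  have kcvg : kappa * del n @[n --> \oo] --> (0 : R).
    by rewrite -[X in _ --> X](mulr0 kappa); apply: cvgM => //; exact: cvg_cst.
  rewrite -[X in _ --> X]mulr1.
  have -> : (fun n => b n / del n) =
      fun n => - kappa * ((expR (kappa * del n) - 1) / (kappa * del n)).
    apply/funext => n; rewrite /b; field.
    by rewrite ?(lt_eqF kappa0) ?(gt_eqF (d0 n)).
  by apply: cvgM; [exact: cvg_cst|exact: expR_difference_quotient].
(* For [s] in the cell [l], the visit takes place at [next_grid (del n) s] and the steps left cover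
   exactly [t - next_grid (del n) s], which tends to [t - s]. *)
have Fcvg s : `[0, t[%classic s ->
    F n (Num.truncn (s / del n)) @[n --> \oo] --> return_prob P X i s * h (t - s).
  rewrite /= in_itv/= => /andP[s0 st].
  have gs := @right_cvg_grid _ _ id del s d0 s0 dcvg.
  apply: cvgM.
    exact: (return_prob_right_continuous_grid HX d0 s0 dcvg).
  apply: (@mean_survival_cvg t (t - s) (fun n => n - Num.truncn (s / del n))%N) => //.
  - by rewrite subr_ge0 (ltW st)/= gerBl.
  - by move=> n; rewrite (leq_trans (leq_subr _ _)).
  have -> : (fun n => (n - Num.truncn (s / del n))%N%:R * (t / n.+1%:R)) =
      fun n => t - next_grid (del n) s.
    apply/funext => n; rewrite natrB; last first.
      by rewrite truncn_le_nat ltr_pdivrMr// /del mulrCA divff// mulr1.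
    by rewrite /next_grid /del -!natr1; field; rewrite natr1.
  apply: cvgB; first exact: cvg_cst.
  by apply: gs; exact: cvg_at_right_filter.
have Icvg : \int[mu]_(s in `[0, t[) F n (Num.truncn (s / del n)) @[n --> \oo] -->
    \int[mu]_(s in `[0, t[) (return_prob P X i s * h (t - s)).
  have mF n : measurable_fun (`[0, t[%classic : set R)
      (fun s => F n (Num.truncn (s / del n))).
    by apply: measurable_funTS; exact: measurable_truncn.
  apply: (@bounded_cvg _ _ _ _ _ _ _ 1) => //.
  - exact: lebesgue_itv_lty.
  - exact: (@measurable_fun_cvg _ _ _ _ _ _ mF).
  - exact/aeW.
have := cvgD ucvg (cvgM bcvg Icvg).
rewrite [X in X @ _ --> _](_ : _ = fun=> 1); last exact: funext E.
move=> /(_ _ _) L; rewrite -mulNr.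
by have := cvg_lim (@norm_hausdorff _ _) L; rewrite lim_cst// => <-.
Qed.

End renewal_equation.

(** * Asymptotics of one-sided convolutions *)

Section one_sided.
Context {R : realType}.
Local Notation mu := (@lebesgue_measure R).
Local Open Scope ereal_scope.
Implicit Types f g w : R -> \bar R.

(* The value at [0] is dropped as well, so that junk values such as
   [0 `^ (a - 1)] play no role. *)
Definition ext (f : R -> R) (s : R) : \bar R :=
  if (0 < s)%R then (f s)%:E else 0.

Lemma ext_gt0 (f : R -> R) s : (0 < s)%R -> ext f s = (f s)%:E.
Proof. by rewrite /ext => ->. Qed.

Lemma ext_le0 (f : R -> R) s : (s <= 0)%R -> ext f s = 0.
Proof. by rewrite /ext ltNge => ->. Qed.

Lemma nnm_ext (f : R -> R) : measurable_fun (`]0%R, +oo[%classic : set R) f ->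
  (forall s, (0 < s)%R -> (0 <= f s)%R) -> nnm (ext f).
Proof.
move=> mf f0; split; last first.
  by move=> s; rewrite /ext; case: ifP => // s0; rewrite lee_fin f0.
have -> : ext f = (EFin \o f) \_ `]0%R, +oo[.
  apply/funext => s; rewrite patchE /ext; case: ifPn => s0.
    by rewrite mem_set//= in_itv/= s0.
  by rewrite memNset//= in_itv/= andbT; exact/negP.
by apply/(measurable_restrictT (EFin \o f)) => //; exact/measurable_EFinP.
Qed.

Definition heaviside : R -> \bar R := ext (fun=> 1%R).

Lemma nnm_heaviside : nnm heaviside.
Proof. by apply: nnm_ext => //; exact: measurable_cst. Qed.

Lemma conv_heaviside f t : nnm f ->
  conv f heaviside t = \int[mu]_(s in `]-oo, t[) f s.
Proof.
move=> Hf; rewrite [RHS]integral_mkcond; apply: eq_integral => s _.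
rewrite patchE /heaviside /ext subr_gt0; case: ifPn => st.
  by rewrite mem_set//= ?in_itv//= mule1.
by rewrite memNset//= ?in_itv/= ?mule0//; exact/negP.
Qed.

Lemma conv_ext_le0 (f g : R -> R) t : (t <= 0)%R -> conv (ext f) (ext g) t = 0.
Proof.
move=> t0; rewrite /conv integral0_eq// => s _.
have [s0|s0] := ltP 0%R s; last by rewrite [ext f s]ext_le0// mul0e.
by rewrite [ext g _]ext_le0 ?mule0// subr_le0 (le_trans t0)// ltW.
Qed.

(** Restricted to the positive axis, since [ext f] may jump up from 0 at the origin. *)
Definition nonincreasing_gt0 w := forall x y, (0 < x)%R -> (x <= y)%R -> w y <= w x.

(** Beyond [M] use [f <= g]; before [M] use [w (t - s) <= w (t - M)], which leaves the mass of [f]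
    below [M] as a factor. *)
Lemma conv_comparison f g w (M t : R) : nnm f -> nnm g -> nnm w ->
  nonincreasing_gt0 w -> (forall s, (M <= s)%R -> f s <= g s) -> (M < t)%R ->
  conv f w t <= conv g w t + conv f heaviside M * w (t - M)%R.
Proof.
move=> Hf Hg Hw wd fg Mt.
have [mfh fh0] := nnm_section M Hf nnm_heaviside.
have [mgw gw0] := nnm_section t Hg Hw.
have [mfw fw0] := nnm_section t Hf Hw.
have w0 := Hw.2 (t - M)%R.
rewrite /conv -ge0_integralZr// -ge0_integralD//; last 2 first.
  by move=> s _; exact: mule_ge0.
  by apply: emeasurable_funM => //; exact: measurable_cst.
apply: ge0_le_integral => //.
  apply: emeasurable_funD => //.
  by apply: emeasurable_funM => //; exact: measurable_cst.
move=> s _; have [Ms|sM] := leP M s.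
  apply: (@le_trans _ _ (g s * w (t - s)%R)).
    by apply: lee_wpmul2r; [exact: Hw.2|exact: fg].
  by apply: leeDl; exact: mule_ge0.
rewrite /heaviside ext_gt0 ?subr_gt0// mule1.
apply: (@le_trans _ _ (f s * w (t - M)%R)); last exact: leeDr.
apply: lee_wpmul2l; first exact: Hf.2.
by apply: wd; rewrite ?subr_gt0// lerD2l lerN2 ltW.
Qed.

(* [f ~ g] at [+oo], without quotients so that it makes sense in [\bar R]. *)
Definition eqv f g := forall e : R, (0 < e)%R -> \forall t \near +oo%R,
  f t <= (1 + e)%:E * g t /\ g t <= (1 + e)%:E * f t.

Lemma eqv_sym f g : eqv f g -> eqv g f.
Proof. by move=> fg e /fg; apply: filterS => t []. Qed.

Lemma eqv_trans g f k : (forall t, 0 <= f t) -> (forall t, 0 <= k t) ->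
  eqv f g -> eqv g k -> eqv f k.
Proof.
move=> f0 k0 fg gk e e0.
(* As [e' <= 1], the square of [1 + e'] is at most [1 + 3 e']. *)
pose e' : R := (Num.min 1 (e / 3))%R.
have e'0 : (0 < e')%R by rewrite lt_min ltr01 divr_gt0.
have e'e : ((1 + e') * (1 + e') <= 1 + e)%R.
  have h1 : (e' <= 1)%R by rewrite ge_min lexx.
  have h2 : (e' <= e / 3)%R by rewrite ge_min lexx orbT.
  have h3 : (e' * e' <= e')%R by rewrite ler_piMr// ltW.
  nra.
have e1 : 0 <= (1 + e')%:E by rewrite lee_fin addr_ge0// ltW.
have [Hfg Hgk] := (fg _ e'0, gk _ e'0).
near=> t.
have [|h1 h2] := near Hfg t; first by [].
have [|h3 h4] := near Hgk t; first by [].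
split.
  apply: (@le_trans _ _ (((1 + e') * (1 + e'))%:E * k t)).
    by rewrite EFinM -muleA; apply: le_trans h1 _; exact: lee_wpmul2l.
  by apply: lee_wpmul2r => //; rewrite lee_fin.
apply: (@le_trans _ _ (((1 + e') * (1 + e'))%:E * f t)).
  by rewrite EFinM -muleA; apply: le_trans h4 _; exact: lee_wpmul2l.
by apply: lee_wpmul2r => //; rewrite lee_fin.
Unshelve. all: by end_near. Qed.

Lemma eqv_near f f' g g' : (\forall t \near +oo%R, f t = f' t) ->
  (\forall t \near +oo%R, g t = g' t) -> eqv f g -> eqv f' g'.
Proof.
move=> ff gg fg e /fg H; near=> t.
have <- : f t = f' t by near: t.
have <- : g t = g' t by near: t.
by near: t.
Unshelve. all: by end_near. Qed.

Lemma eqv_EFin (f g : R -> R) : eqv (EFin \o f) (EFin \o g) <->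
  forall e : R, (0 < e)%R -> \forall t \near +oo%R,
    (f t <= (1 + e) * g t /\ g t <= (1 + e) * f t)%R.
Proof.
by split=> fg e /fg; apply: filterS => t; rewrite /= -!EFinM !lee_fin.
Qed.

Lemma eqvZ (a : R) f g : (0 <= a)%R -> eqv f g ->
  eqv (fun t => a%:E * f t) (fun t => a%:E * g t).
Proof.
move=> a0 fg e /fg; apply: filterS => t [h1 h2].
by split; rewrite muleCA; apply: lee_wpmul2l.
Qed.

(** [conv_comparison], used in both directions, compares the two convolutions up to a term
    [C * w (t - M)] from the initial stretch, where [f] and [g] are unrelated. The smallness
    hypothesis makes this term negligible. *)
Lemma eqv_conv f g w : nnm f -> nnm g -> nnm w -> nonincreasing_gt0 w ->
  (forall M, (0 < M)%R -> conv f heaviside M \is a fin_num) ->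
  (forall M, (0 < M)%R -> conv g heaviside M \is a fin_num) ->
  (\forall t \near +oo%R, conv g w t \is a fin_num) ->
  (forall C M e : R, (0 < e)%R -> \forall t \near +oo%R,
    C%:E * w (t - M)%R <= e%:E * conv g w t) ->
  eqv f g -> eqv (conv f w) (conv g w).
Proof.
move=> Hf Hg Hw wd finf fing fingw small fg e e0.
(* Here [(1 + e') / (1 - e') = 1 + e]: in bounding [conv g w], the error [e' * conv g w] is moved to
   the left. In the other direction [2 e' <= e] suffices. *)
pose e' : R := (e / (2 + e))%R.
have e20 : (0 < 2 + e)%R by rewrite addr_gt0.
have e'0 : (0 < e')%R by rewrite divr_gt0.
have e'E : (e' * (2 + e) = e)%R by rewrite divfK// gt_eqF.
have /= [M [Mr HM]] := fg _ e'0.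
pose M' : R := (Num.max M 0 + 1)%R.
have M'0 : (0 < M')%R by rewrite ltr_wpDl// le_max lexx orbT.
have MM' s : (M' <= s)%R -> (M < s)%R.
  by apply: lt_le_trans; rewrite ltr_pwDr// le_max lexx.
have e1 : 0 <= (1 + e')%:E by rewrite lee_fin addr_ge0// ltW.
have e'1 : (0 <= 1 + e')%R by rewrite addr_ge0// ltW.
have H1 t : (M' < t)%R -> conv f w t <=
    (1 + e')%:E * conv g w t + conv f heaviside M' * w (t - M')%R.
  move=> Mt; rewrite -convZl//.
  apply: (conv_comparison Hf (nnmZ e'1 Hg) Hw wd _ Mt) => s Ms.
  exact: (HM s (MM' s Ms)).1.
have H2 t : (M' < t)%R -> conv g w t <=
    (1 + e')%:E * conv f w t + conv g heaviside M' * w (t - M')%R.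
  move=> Mt; rewrite -convZl//.
  apply: (conv_comparison Hg (nnmZ e'1 Hf) Hw wd _ Mt) => s Ms.
  exact: (HM s (MM' s Ms)).2.
have S1 := small (fine (conv f heaviside M')) M' e' e'0.
have S2 := small (fine (conv g heaviside M')) M' e' e'0.
near=> t.
have Mt : (M' < t)%R by near: t; exact: (nbhs_pinfty_gt (num_real _)).
have s1 : conv f heaviside M' * w (t - M')%R <= e'%:E * conv g w t.
  by rewrite -(fineK (finf _ M'0)); near: t.
have s2 : conv g heaviside M' * w (t - M')%R <= e'%:E * conv g w t.
  by rewrite -(fineK (fing _ M'0)); near: t.
have fint : conv g w t \is a fin_num by near: t.
have {}H1 := le_trans (H1 t Mt) (leeD2l _ s1).
have {}H2 := le_trans (H2 t Mt) (leeD2l _ s2).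
have x0 : 0 <= conv g w t by exact: (nnm_conv Hg Hw).2.
have y0 : 0 <= conv f w t by exact: (nnm_conv Hf Hw).2.
have finf' : conv f w t \is a fin_num.
  by rewrite ge0_fin_numE// (le_lt_trans H1)// -(fineK fint) -!EFinM -EFinD ltry.
move: H1 H2 x0 y0; rewrite -(fineK fint) -(fineK finf').
move: (fine _) (fine _) => x y; rewrite -!EFinM -!EFinD !lee_fin => H1 H2 x0 y0.
by split; nra.
Unshelve. all: by end_near. Qed.

End one_sided.

(** * Powers, Beta and Gamma integrals *)

Section powers.
Context {R : realType}.
Local Notation mu := (@lebesgue_measure R).
Local Open Scope ereal_scope.

(** Indexed as in the Gamma integral, so that [conv (pw a) (pw b) 1] is the Beta integral
    [B (a, b)]. *)
Definition pw (a : R) : R -> \bar R := ext (fun s => s `^ (a - 1))%R.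

Lemma nnm_pw a : nnm (pw a).
Proof.
apply: nnm_ext; last by move=> s _; exact: powR_ge0.
by apply: measurable_funTS; exact: measurable_powR.
Qed.

Lemma pw_nonincreasing a : (a <= 1)%R -> nonincreasing_gt0 (pw a).
Proof.
move=> a1 x y x0 xy; have y0 := lt_le_trans x0 xy.
rewrite /pw !ext_gt0// lee_fin -opprB !powRN lef_pV2 ?posrE ?powR_gt0//.
by apply: ge0_ler_powR; rewrite ?nnegrE ?subr_ge0// ltW.
Qed.

(** Substitution of [t * s] for [s]: the two powers contribute [a - 1] and [b - 1] to the exponent
    of [t], the change of measure 1. *)
Lemma conv_pw_scale (a b t : R) : (0 < t)%R ->
  conv (pw a) (pw b) t = (t `^ (a + b - 1))%:E * conv (pw a) (pw b) 1.
Proof.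
move=> t0; have [mpp pp0] := nnm_section t (nnm_pw a) (nnm_pw b).
have [mpq pq0] := nnm_section 1 (nnm_pw a) (nnm_pw b).
rewrite /conv (ge0_integral_affine 0 t0 mpp pp0).
transitivity (t%:E * \int[mu]_s ((t `^ (a - 1) * t `^ (b - 1))%:E *
    (pw a s * pw b (1 - s)%R))).
  congr (_ * _); apply: eq_integral => s _; rewrite addr0.
  have [s0|s0] := ltP 0%R s; last first.
    by rewrite /pw [ext _ s]ext_le0// [ext _ (t * s)%R]ext_le0 ?pmulr_rle0// !mul0e mule0.
  have [s1|s1] := ltP s 1%R; last first.
    rewrite /pw [ext _ (t - _)%R]ext_le0; last by rewrite subr_le0 ler_peMr// ltW.
    by rewrite [ext _ (1 - _)%R]ext_le0 ?subr_le0// !mule0.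
  have s10 : (0 < 1 - s)%R by rewrite subr_gt0.
  have -> : (t - t * s = t * (1 - s))%R by rewrite mulrBr mulr1.
  rewrite /pw !ext_gt0 ?mulr_gt0// -!EFinM !powRM ?(ltW s0) ?(ltW s10) ?(ltW t0)//.
  by congr EFin; ring.
rewrite ge0_integralZl//; last by rewrite lee_fin mulr_ge0// powR_ge0.
rewrite muleA -EFinM -powRD; last by apply/implyP => _; rewrite gt_eqF.
congr (_%:E * _); rewrite -[X in (X * _)%R]powRr1 ?ltW// -powRD; last first.
  by apply/implyP => _; rewrite gt_eqF.
by congr (t `^ _)%R; ring.
Qed.

Lemma integral_pos_FTC (f F : R -> R) (u v : R) : (0 < u)%R -> (u < v)%R ->
  (forall x : R, (0 < x)%R -> is_derive x 1%R F (f x)) ->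
  (forall x : R, (0 < x)%R -> {for x, continuous f}) ->
  \int[mu]_(s in `[u, v]) (f s)%:E = (F v - F u)%:E.
Proof.
move=> u0 uv dF cf; have v0 := lt_trans u0 uv.
have cF (x : R) : (0 < x)%R -> {for x, continuous F}.
  move=> /dF Fx; apply/differentiable_continuous/derivable1_diffP.
  exact: ex_derive.
rewrite (continuous_FTC2 uv (F := F)) ?EFinB//.
- apply: continuous_in_subspaceT => x; rewrite inE/= in_itv/= => /andP[ux _].
  exact: cf (lt_le_trans u0 ux).
- split.
  + move=> x; rewrite in_itv/= => /andP[ux _].
    have Fx := dF x (lt_trans u0 ux); exact: ex_derive.
  + by apply: cvg_at_right_filter; exact: cF.
  + by apply: cvg_at_left_filter; exact: cF.
- move=> x; rewrite in_itv/= => /andP[ux _]; rewrite derive1E.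
  have Fx := dF x (lt_trans u0 ux); exact: derive_val.
Qed.

Lemma powR_continuous_gt0 (a x : R) : (0 < x)%R ->
  {for x, continuous (fun s : R => s `^ a)%R}.
Proof.
move=> x0; apply/differentiable_continuous/derivable1_diffP.
by have Fx := is_derive1_powR a x0; exact: ex_derive.
Qed.

Lemma integral_powR (a u v : R) : a != 0%R -> (0 < u)%R -> (u < v)%R ->
  \int[mu]_(s in `[u, v]) (s `^ (a - 1))%:E = ((v `^ a - u `^ a) / a)%:E.
Proof.
move=> a0 u0 uv.
have dF (x : R) : (0 < x)%R ->
    is_derive x 1%R (a^-1 \*: (fun s : R => s `^ a))%R (x `^ (a - 1))%R.
  move=> x0; have Fx := is_derive1_powR a x0; apply: is_derive_eq.
  by rewrite /GRing.scale /= mulrA mulVf// mul1r.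
rewrite (integral_pos_FTC u0 uv dF); last by move=> x x0; exact: powR_continuous_gt0.
by congr EFin; rewrite /GRing.scale /= -mulrBr mulrC.
Qed.

Lemma integral_inv (u v : R) : (0 < u)%R -> (u < v)%R ->
  \int[mu]_(s in `[u, v]) (s^-1)%:E = (ln v - ln u)%:E.
Proof.
move=> u0 uv.
have dF (x : R) : (0 < x)%R -> is_derive x 1%R (@ln R) (x^-1)%R.
  by move=> x0; exact: is_derive1_ln.
apply: (integral_pos_FTC u0 uv dF).
by move=> x x0; apply: inv_continuous; rewrite gt_eqF.
Qed.

(** For [a < 1] the integrand is unbounded near 0, so the fundamental theorem is applied on
    [[u n, t]], followed by monotone convergence. *)
Lemma conv_pw_heaviside (a t : R) : (0 < a)%R -> (0 < t)%R ->
  conv (pw a) heaviside t = (t `^ a / a)%:E.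
Proof.
move=> a0 t0; rewrite conv_heaviside; last exact: nnm_pw.
rewrite integral_itv_bndo_bndc; last first.
  by apply: measurable_funTS; exact: (nnm_pw a).1.
(* With [n.+2] the inequality [u n < t] is strict already at [n = 0], as [integral_powR] demands. *)
pose u (n : nat) : R := (t / n.+2%:R)%R.
have u0 n : (0 < u n)%R by rewrite divr_gt0.
have ut n : (u n < t)%R by rewrite ltr_pdivrMr// ltr_pMr// ltr1n.
have ucvg : (u n @[n --> \oo] --> (0 : R))%R.
  have := divn_cvg0 t; rewrite -(cvg_shiftS (fun n => t / n.+1%:R)%R); exact.
pose F n : set R := `[u n, t]%classic.
have ndF : nondecreasing_seq F.
  move=> m n mn; apply/subsetPset => s; rewrite /F /= !in_itv/= => /andP[us ->].
  by rewrite andbT (le_trans _ us)// ler_pM2l// lef_pV2 ?posrE// ler_nat.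
have UF : \bigcup_n F n = `]0%R, t]%classic.
  apply/seteqP; split => [s [n _]|s]; rewrite /F /= !in_itv/=.
    by move=> /andP[us ->]; rewrite (lt_le_trans (u0 n) us).
  move=> /andP[s0 st]; have /cvgr_lt/(_ _ s0) [N _ HN] := ucvg.
  by exists N => //=; rewrite in_itv/= st andbT ltW//; exact: (HN N (leqnn N)).
have mpwF n : measurable_fun (F n) (pw a).
  by apply: measurable_funTS; exact: (nnm_pw a).1.
have pw0 n x : F n x -> 0 <= pw a x by move=> _; exact: (nnm_pw a).2.
have := @ge0_nondecreasing_set_cvg_integral _ (measurableTypeR R) R F (pw a) mu ndF (fun n => measurable_itv _) mpwF pw0.
rewrite UF; have -> : \int[mu]_(s in `]0%R, t]) pw a s = \int[mu]_(s in `]-oo, t]) pw a s.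
  rewrite [LHS]integral_mkcond [RHS]integral_mkcond; apply: eq_integral => s _.
  rewrite !patchE; have [s0|s0] := ltP 0%R s.
    congr (if _ then _ else _); apply/idP/idP; rewrite !inE/= !in_itv/= ?s0//.
  by rewrite /pw ext_le0// !if_same.
have -> : (fun n => \int[mu]_(s in F n) pw a s) =
    fun n => ((t `^ a - u n `^ a) / a)%:E.
  apply/funext => n; rewrite -integral_powR ?gt_eqF//.
  apply: eq_integral => s; rewrite inE /F /= in_itv/= => /andP[us _].
  by rewrite /pw ext_gt0// (lt_le_trans (u0 n) us).
move=> H; suff K : ((t `^ a - u n `^ a) / a)%:E @[n --> \oo] --> (t `^ a / a)%:E.
  exact: (cvg_unique _ H K).
apply: cvg_EFin; first exact: nearW.
rewrite -[X in _ --> (X / a)%R]subr0; apply: cvgM; last exact: cvg_cst.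
apply: cvgB; first exact: cvg_cst.
apply: (cvg_comp u _ _ (powR_cvg0 a0)).
move=> A /= [e e0 eA]; move/cvgr_dist_lt : ucvg => /(_ _ e0).
by apply: filterS => n un; apply: eA => //=.
Qed.

(* Euler's Beta integral [B (a, 1 - a)]. *)
Definition beta_reflect (a : R) : \bar R := conv (pw a) (pw (1 - a)) 1.

Lemma conv_pw_reflect (a t : R) : (0 < t)%R ->
  conv (pw a) (pw (1 - a)) t = beta_reflect a.
Proof.
move=> t0; rewrite (conv_pw_scale _ _ t0).
have -> : (a + (1 - a) - 1 = 0)%R by ring.
by rewrite powRr0 mul1e.
Qed.

Lemma heavisideE : heaviside = pw 1.
Proof. by apply/funext => s; rewrite /heaviside /pw /ext subrr powRr0. Qed.

Lemma heaviside_le_pw (b s : R) : (0 < b <= 1)%R -> (s < 1)%R ->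
  heaviside s <= pw b s.
Proof.
move=> /andP[b0 b1] s1; have [s0|s0] := ltP 0%R s; last first.
  by rewrite /heaviside /pw !ext_le0.
have := pw_nonincreasing b1 s0 (ltW s1).
by rewrite heavisideE /pw !ext_gt0// subrr powRr0 powR1.
Qed.

(** On []0, 1[] both powers are at least 1, and two Heaviside functions convolve to 1 at time 1. The
    bound makes the Beta constant a legitimate divisor and excludes [0 * oo] in [Gamma_reflect]. *)
Lemma beta_reflect_ge1 (a : R) : (0 < a < 1)%R -> 1 <= beta_reflect a.
Proof.
move=> /andP[a0 a1].
have <- : conv (@heaviside R) heaviside 1 = 1.
  by rewrite {1}heavisideE conv_pw_heaviside// powR1 divr1.
apply: le_conv; [exact: nnm_heaviside|exact: nnm_heaviside|exact: nnm_pw|exact: nnm_pw|].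
move=> s; have [s1|s1] := ltP s 1%R; last first.
  by rewrite /heaviside [ext _ (1 - s)%R]ext_le0 ?subr_le0// mule0 mule_ge0//;
    exact: (nnm_pw _).2.
have [s0|s0] := ltP 0%R s; last first.
  by rewrite /heaviside [ext _ s]ext_le0// mul0e mule_ge0//; exact: (nnm_pw _).2.
apply: lee_pmul; rewrite ?(nnm_heaviside.2)//.
  by apply: heaviside_le_pw => //; rewrite a0 ltW.
by apply: heaviside_le_pw; rewrite ?subr_gt0 ?a1 ?gerBl ?(ltW a0)// ltrBlDr ltrDl.
Qed.

(** Splitting at 1/2 separates the singularities: to its right [pw a] is at most its value at 1/2,
    to its left the other factor is, and each remaining power is integrable. *)
Lemma beta_reflect_fin (a : R) : (0 < a < 1)%R -> beta_reflect a \is a fin_num.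
Proof.
move=> /andP[a0 a1].
have b0 : (0 < 1 - a)%R by rewrite subr_gt0.
have b1 : (1 - a <= 1)%R by rewrite gerBl ltW.
have h0 : (0 < 2^-1 :> R)%R by [].
have h1 : (2^-1 < 1 :> R)%R by rewrite invf_lt1// ltr1n.
rewrite ge0_fin_numE; last exact: (nnm_conv (nnm_pw _) (nnm_pw _)).2.
apply: le_lt_trans (conv_comparison (g := fun s => (2^-1 `^ (a - 1))%:E * heaviside s)
  (nnm_pw a) _ (nnm_pw _) (pw_nonincreasing b1) _ h1) _.
- by apply: nnmZ; [exact: powR_ge0|exact: nnm_heaviside].
- move=> s hs; have s0 := lt_le_trans h0 hs.
  rewrite /heaviside ext_gt0// mule1.
  have := pw_nonincreasing (ltW a1) h0 hs.
  by rewrite /pw [ext _ 2^-1]ext_gt0.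
rewrite convZl; [|exact: powR_ge0|exact: nnm_heaviside|exact: nnm_pw].
rewrite (convC _ nnm_heaviside (nnm_pw _)) !conv_pw_heaviside//.
have h2 : (0 < 1 - 2^-1 :> R)%R by rewrite subr_gt0.
by rewrite /pw ext_gt0// -!EFinM -EFinD ltry.
Qed.

End powers.

(** * The Beta constant as a product of Gamma values *)

Section gamma_reflection.
Context {R : realType}.
Local Notation mu := (@lebesgue_measure R).
Local Open Scope ereal_scope.

Definition gamma_density (a s : R) : \bar R := (expR (- s))%:E * pw a s.

Lemma nnm_exp : nnm (fun s : R => (expR (- s))%:E).
Proof.
split; last by move=> x; rewrite lee_fin expR_ge0.
by apply/measurable_EFinP; apply: measurableT_comp => //; exact: oppr_measurable.
Qed.

Lemma nnmM (f g : R -> \bar R) : nnm f -> nnm g -> nnm (fun s => f s * g s).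
Proof.
move=> [mf f0] [mg g0]; split; first exact: emeasurable_funM.
by move=> x; exact: mule_ge0.
Qed.

Lemma nnm_gamma_density a : nnm (gamma_density a).
Proof. by apply: nnmM; [exact: nnm_exp|exact: nnm_pw]. Qed.

Definition egamma (a : R) : \bar R := \int[mu]_s gamma_density a s.

Lemma GammaE (a : R) : Gamma a = fine (egamma a).
Proof.
rewrite /Gamma /Rintegral; congr fine; rewrite integral_mkcond.
apply: eq_integral => s _; rewrite patchE /gamma_density /pw /ext; case: ifPn => s0.
  by rewrite inE/= in_itv/= andbT in s0; rewrite s0 -EFinM mulrC.
rewrite ifF ?mule0//; apply/negbTE/negP => s1; move/negP : s0; apply.
by rewrite inE/= in_itv/= s1.
Qed.

Lemma egamma1 : \int[mu]_s ((expR (- s))%:E * heaviside s) = 1.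
Proof.
transitivity (\int[mu]_(s in `[0%R, +oo[) (expR (- s))%:E).
  rewrite -integral_itv_obnd_cbnd; last first.
    by apply: measurable_funTS; exact: nnm_exp.1.
  rewrite [RHS]integral_mkcond; apply: eq_integral => s _.
  rewrite patchE /heaviside /ext; case: ifPn => s0.
    by rewrite mem_set ?mule1//= in_itv/= s0.
  by rewrite memNset ?mule0//= in_itv/= andbT; exact/negP.
rewrite -(integral_exponential_pdf (@ltr01 R)) [LHS]integral_mkcond.
apply: eq_integral => s _; rewrite patchE; have [s0|s0] := ltP s 0%R.
  by rewrite lt0_exponential_pdf// memNset//= in_itv/= andbT; apply/negP; rewrite -ltNge.
by rewrite exponential_pdfE// mem_set/= ?in_itv/= ?s0// mul1r mulN1r.
Qed.

(** In the convolution of the two densities at [t] the exponentials combine to [exp (- t)], leaving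
    a Beta integral that is the same for all [t > 0]. The outer integral of [exp (- t)] is then
    1. *)
Lemma egamma_reflect (a : R) : egamma a * egamma (1 - a) = beta_reflect a.
Proof.
have E s : (0 <= (expR (- s))%:E :> \bar R) by rewrite lee_fin expR_ge0.
have [Hb Ha] := (nnm_gamma_density (1 - a), nnm_gamma_density a).
pose F (z : R * R) := gamma_density a z.1 * gamma_density (1 - a) (z.2 - z.1)%R.
have mF : measurable_fun setT F by exact: nnm_conv_integrand.
have F0 z : 0 <= F z by apply: mule_ge0; [exact: Ha.2|exact: Hb.2].
transitivity (\int[mu]_s \int[mu]_t F (s, t)).
  have gb : 0 <= egamma (1 - a) by apply: integral_ge0 => s _; exact: Hb.2.
  rewrite {1}/egamma -(ge0_integralZr mu measurableT Ha.1 (fun s _ => Ha.2 s) gb).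
  apply: eq_integral => s _.
  rewrite /egamma -(ge0_integralZl mu measurableT Hb.1 (fun s _ => Hb.2 s) (Ha.2 s)).
  have Hs : nnm (fun t => gamma_density a s * gamma_density (1 - a) t).
    apply: nnmM => //; split; first exact: measurable_cst.
    by move=> _; exact: Ha.2.
  by rewrite -(ge0_integral_shift s Hs.1 Hs.2).
rewrite (fubini_tonelli (m1 := mu) (m2 := mu) F mF F0).
transitivity (\int[mu]_t (beta_reflect a * ((expR (- t))%:E * heaviside t))).
  apply: eq_integral => t _; have [t0|t0] := ltP 0%R t; last first.
    rewrite /heaviside [ext _ t]ext_le0// !mule0 integral0_eq// => s _.
    rewrite /F /= /gamma_density /pw; have [s0|s0] := ltP 0%R s; last first.
      by rewrite [ext _ s]ext_le0// mule0 mul0e.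
    by rewrite [ext _ (t - s)%R]ext_le0 ?mule0// subr_le0 (le_trans t0)// ltW.
  rewrite /heaviside ext_gt0// mule1 -(conv_pw_reflect a t0) muleC /conv.
  have [mc c0] := nnm_section t (nnm_pw a) (nnm_pw (1 - a)).
  rewrite -ge0_integralZl//; apply: eq_integral => s _.
  rewrite /F /gamma_density/= muleACA -EFinM -expRD; congr ((expR _)%:E * _).
  by rewrite opprB addKr.
have He := nnmM nnm_exp (@nnm_heaviside R).
rewrite ge0_integralZl//; first by rewrite egamma1 mule1.
- exact: He.1.
- by move=> s _; exact: He.2.
- exact: (nnm_conv (nnm_pw _) (nnm_pw _)).2.
Qed.

(** [Gamma] is a [fine], so both integrals must be shown finite. Their product is finite and at
    least 1, whereas an infinite factor would make it 0 or infinite. *)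
Lemma Gamma_reflect (a : R) : (0 < a < 1)%R ->
  (Gamma (1 - a) * Gamma a)%R = fine (beta_reflect a).
Proof.
move=> a01; have := egamma_reflect a.
have := beta_reflect_fin a01; have := beta_reflect_ge1 a01.
have [Hb Ha] := (nnm_gamma_density (1 - a), nnm_gamma_density a).
have ga : 0 <= egamma a by apply: integral_ge0 => s _; exact: Ha.2.
have gb : 0 <= egamma (1 - a) by apply: integral_ge0 => s _; exact: Hb.2.
rewrite !GammaE; move: ga gb; case: (egamma a) => [x| |]; case: (egamma (1 - a)) => [y| |] //=.
- by move=> _ _ _ _ <-; rewrite mulrC.
- rewrite lee_fin le_eqVlt => /predU1P[<-|x0] _ g1 gf E.
    by move: g1; rewrite -E mul0e lee_fin ler10.
  by move: gf; rewrite -E gt0_muley// lte_fin.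
- move=> _; rewrite lee_fin le_eqVlt => /predU1P[<-|y0] g1 gf E.
    by move: g1; rewrite -E mule0 lee_fin ler10.
  by move: gf; rewrite -E gt0_mulye// lte_fin.
- by move=> _ _ _ gf E; move: gf; rewrite -E mulyy.
Qed.

End gamma_reflection.

(** * Growth and monotone density *)

Section growth.
Context {R : realType}.

Lemma near_powR_ge (a K : R) : 0 < a -> \forall t \near +oo, K <= t `^ a.
Proof.
move=> a0; near=> t.
have Kt : (Num.max K 0) `^ (a^-1) <= t.
  by near: t; exact: (nbhs_pinfty_ge (num_real _)).
apply: (@le_trans _ _ (Num.max K 0)); first by rewrite le_max lexx.
have m0 : 0 <= Num.max K 0 by rewrite le_max lexx orbT.
rewrite -[leLHS](powRr1 m0) -(mulVf (lt0r_neq0 a0)) powRrM.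
by apply: ge0_ler_powR; rewrite ?nnegrE ?powR_ge0// ?(ltW a0)// (le_trans _ Kt)// powR_ge0.
Unshelve. all: by end_near. Qed.

Lemma near_powR_le (a e : R) : 0 < a -> 0 < e -> \forall t \near +oo, t `^ (- a) <= e.
Proof.
move=> a0 e0; near=> t.
have H : e^-1 <= t `^ a by near: t; exact: near_powR_ge.
rewrite powRN -[leRHS]invrK lef_pV2// ?posrE ?invr_gt0//.
by rewrite (lt_le_trans _ H)// invr_gt0.
Unshelve. all: by end_near. Qed.

Lemma near_ln_ge (K : R) : \forall t \near +oo, K <= ln t.
Proof.
near=> t.
have H : expR K <= t by near: t; exact: (nbhs_pinfty_ge (num_real _)).
by rewrite -[leLHS]expRK ler_ln ?posrE ?expR_gt0// (lt_le_trans _ H)// expR_gt0.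
Unshelve. all: by end_near. Qed.

Lemma near_shift (M : R) (Q : R -> Prop) :
  (\forall t \near +oo, Q t) -> \forall t \near +oo, Q (t - M).
Proof.
move=> [N [_ HN]]; near=> t; apply: HN; rewrite ltrBrDr.
by near: t; exact: (nbhs_pinfty_gt (num_real _)).
Unshelve. all: by end_near. Qed.

Lemma near_scale (a : R) (Q : R -> Prop) : 0 < a ->
  (\forall t \near +oo, Q t) -> \forall t \near +oo, Q (a * t).
Proof.
move=> a0 [N [_ HN]]; near=> t; apply: HN; rewrite -ltr_pdivrMl//.
by near: t; exact: (nbhs_pinfty_gt (num_real _)).
Unshelve. all: by end_near. Qed.

Lemma asymp_bounds (f g : R -> R) (e : R) : 0 < e ->
  (\forall t \near +oo, 0 < g t) -> asymp_equiv f g ->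
  \forall t \near +oo, f t <= (1 + e) * g t /\ g t <= (1 + e) * f t.
Proof.
(* Chosen so that [1 - e' = 1 / (1 + e)]; also [e' <= e]. *)
move=> e0 g0 fg; pose e' : R := e / (1 + e).
have e10 : 0 < 1 + e by rewrite addr_gt0.
have e'0 : 0 < e' by rewrite divr_gt0.
have e'E : e' * (1 + e) = e by rewrite divfK// gt_eqF.
have /cvgrPdist_lt/(_ _ e'0) H := fg.
near=> t.
have gt0 : 0 < g t by near: t.
have : `|1 - f t / g t| < e' by near: t.
have E : f t = f t / g t * g t by rewrite divfK// gt_eqF.
rewrite {2 3}E; move: (f t / g t) => x; rewrite ltr_distlC => /andP[h1 h2].
have x1 : x <= 1 + e by nra.
have x2 : 1 <= (1 + e) * x by nra.
split; first by rewrite ler_pM2r.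
by rewrite mulrA -[leLHS]mul1r ler_pM2r.
Unshelve. all: by end_near. Qed.

Lemma asymp_intro (f g : R -> R) : (\forall t \near +oo, 0 < g t) ->
  (forall e : R, 0 < e -> \forall t \near +oo,
    (1 - e) * g t <= f t <= (1 + e) * g t) -> asymp_equiv f g.
Proof.
move=> g0 H; apply/cvgrPdist_le => e e0; have He := H e e0.
near=> t.
have gt0 : 0 < g t by near: t.
have /andP[h1 h2] : (1 - e) * g t <= f t <= (1 + e) * g t by near: t.
by rewrite ler_distlC ler_pdivlMr// ler_pdivrMr// h1 h2.
Unshelve. all: by end_near. Qed.

Lemma powR_quotient (a e : R) : 0 < e -> exists2 d : R, 0 < d &
  forall x, 0 < `|x| -> `|x| < d -> `|((1 + x) `^ a - 1) / x - a| <= e.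
Proof.
move=> e0.
have Fx := is_derive1_powR a (@ltr01 R).
have D : h^-1 *: ((h *: 1 + 1) `^ a - 1 `^ a) @[h --> 0^'] --> (a * 1 `^ (a - 1) : R).
  by case: Fx => /= dE E1; rewrite -[X in _ --> X]E1; exact: dE.
move: D; rewrite powR1 mulr1 => /cvgrPdist_le/(_ _ e0)[d /= d0 Hd].
exists d => // x x0 xd; have := Hd x; rewrite /= sub0r normrN => /(_ xd).
rewrite -normr_gt0 => /(_ x0); rewrite distrC.
by rewrite /GRing.scale /= mulr1 mulrC (addrC x).
Qed.

(** [h t * del * t] is at most the increment of [A] over [[(1 - del) t, t]] and at least that over
    [[t, (1 + del) t]]. Both increments are close to [a * K * t^a * del], by the derivative of the
    power at 1. *)
Lemma monotone_density (A h : R -> R) (K a : R) : 0 < K -> 0 < a ->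
  (forall s t : R, 0 < s -> s <= t -> h t * (t - s) <= A t - A s <= h s * (t - s)) ->
  (forall e : R, 0 < e -> \forall t \near +oo,
    A t <= (1 + e) * (K * t `^ a) /\ K * t `^ a <= (1 + e) * A t) ->
  asymp_equiv h (fun t => a * K * t `^ (a - 1)).
Proof.
move=> K0 a0 incr HA; apply: asymp_intro.
  near=> t; have t0 : 0 < t by near: t; exact: (nbhs_pinfty_gt (num_real _)).
  by rewrite !mulr_gt0// powR_gt0.
move=> e e0.
(* Half of the error pays for replacing the difference quotient of the power by [a], half for
   replacing [A] by [K * t^a]. *)
have e10 : 0 < a * e / 2 by rewrite divr_gt0// mulr_gt0.
have [d d0 Hd] := powR_quotient a e10.
move: e10 Hd; set e1 : R := a * e / 2 => e10 Hd.
have e1E : a * e = 2 * e1 by rewrite /e1; field.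
pose del : R := Num.min (d / 2) (1 / 2).
have del0 : 0 < del by rewrite lt_min !divr_gt0.
have deld : del < d by rewrite gt_min ltr_pdivrMr// ltr_pMr// ltr1n.
have del1 : del < 1 by rewrite gt_min orbC ltr_pdivrMr// mul1r ltr1n.
have HX : 1 - (1 - del) `^ a <= del * (a + e1).
  have := Hd (- del); rewrite normrN gtr0_norm// => /(_ del0 deld).
  rewrite ler_distl => /andP[_]; rewrite invrN mulrN -mulNr opprB.
  by rewrite ler_pdivrMr// mulrC.
have HY : del * (a - e1) <= (1 + del) `^ a - 1.
  have := Hd del; rewrite gtr0_norm// => /(_ del0 deld).
  by rewrite ler_distl => /andP[+ _]; rewrite ler_pdivlMr// mulrC.
have X0 : 0 < (1 - del) `^ a by rewrite powR_gt0// subr_gt0.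
have Y0 : 0 < (1 + del) `^ a by rewrite powR_gt0// addr_gt0.
have XY : (1 - del) `^ a <= (1 + del) `^ a.
  by apply: ge0_ler_powR; rewrite ?nnegrE; lra.
move: HX HY X0 Y0 XY; set X := (1 - del) `^ a; set Y := (1 + del) `^ a.
move=> HX HY X0 Y0 XY.
have Y10 : 0 < Y + 1 by rewrite addr_gt0.
(* [del] is fixed before [eta], since the error in [A] gets divided by [del]. *)
pose eta : R := Num.min 1 (del * e1 / (Y + 1)).
have eta0 : 0 < eta by rewrite lt_min ltr01 divr_gt0// mulr_gt0.
have eta1 : eta <= 1 by rewrite ge_min lexx.
have etaY : eta * (Y + 1) <= del * e1.
  by rewrite -ler_pdivlMr// ge_min lexx orbT.
have etaX : eta * (X + 1) <= del * e1 by nra.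
have d10 : 0 < 1 - del by rewrite subr_gt0.
have d20 : 0 < 1 + del by rewrite addr_gt0.
have HA1 := HA _ eta0.
have HA2 := near_scale d10 (HA _ eta0).
have HA3 := near_scale d20 (HA _ eta0).
near=> t; have t0 : 0 < t by near: t; exact: (nbhs_pinfty_gt (num_real _)).
have [a1 a2] : A t <= (1 + eta) * (K * t `^ a) /\ K * t `^ a <= (1 + eta) * A t.
  by near: t.
have [b1 b2] : A ((1 - del) * t) <= (1 + eta) * (K * ((1 - del) * t) `^ a) /\
    K * ((1 - del) * t) `^ a <= (1 + eta) * A ((1 - del) * t).
  by near: t.
have [c1 c2] : A ((1 + del) * t) <= (1 + eta) * (K * ((1 + del) * t) `^ a) /\
    K * ((1 + del) * t) `^ a <= (1 + eta) * A ((1 + del) * t).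
  by near: t.
have T0 : 0 < K * t `^ a by rewrite mulr_gt0// powR_gt0.
have TE : K * t `^ a = t * (K * t `^ (a - 1)).
  by rewrite mulrCA mulr_powRB1// ltW.
move: b2 c2; rewrite !powRM ?(ltW t0) ?(ltW d10) ?(ltW d20)// -/X -/Y => b2 c2.
have le1 : (1 - del) * t <= t by nra.
have le2 : t <= (1 + del) * t by nra.
have /andP[i1 _] := incr _ _ (mulr_gt0 d10 t0) le1.
have /andP[_ i2] := incr _ _ t0 le2.
move: a1 a2 b2 c2 i1 i2 TE T0.
have -> : a * K * t `^ (a - 1) = a * (K * t `^ (a - 1)) by rewrite mulrA.
rewrite (mulrCA K X) (mulrCA K Y).
move: (A t) (A ((1 - del) * t)) (A ((1 + del) * t)) (h t) (K * t `^ a).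
move: (K * t `^ (a - 1)) => T' A0 A1 A2 ht T a1 a2 b2 c2 i1 i2 TE T0.
have A1ge : (1 - eta) * (X * T) <= A1.
  have XT : 0 <= X * T by rewrite mulr_ge0// ltW.
  have A10 : 0 <= A1 by nra.
  by have := ler_wpM2l (_ : 0 <= 1 - eta) b2; nra.
have A2ge : (1 - eta) * (Y * T) <= A2.
  have YT : 0 <= Y * T by rewrite mulr_ge0// ltW.
  have A20 : 0 <= A2 by nra.
  by have := ler_wpM2l (_ : 0 <= 1 - eta) c2; nra.
have dt0 : 0 < del * t by rewrite mulr_gt0.
have U : ht * (del * t) <= (del * t) * ((1 + e) * (a * T')).
  have : T * (1 - X + eta * (X + 1)) <= T * (del * (a + e1) + del * e1).
    by rewrite ler_pM2l// lerD.
  rewrite [in leRHS]TE => H; nra.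
have L : (del * t) * ((1 - e) * (a * T')) <= ht * (del * t).
  have : T * (del * (a - e1) - del * e1) <= T * (Y - 1 - eta * (Y + 1)).
    by rewrite ler_pM2l// lerB.
  rewrite [in leLHS]TE => H; nra.
apply/andP; split.
  by rewrite -(ler_pM2l dt0) (mulrC (del * t) ht).
by rewrite -(ler_pM2l dt0) (mulrC (del * t) ht).
Unshelve. all: by end_near. Qed.

End growth.

(** * Asymptotics of the renewal equation *)

Section renewal_asymptotics.
Context {R : realType}.
Local Notation mu := (@lebesgue_measure R).
Variables (p h : R -> R) (lam : R).
Hypothesis lam0 : 0 < lam.
Hypothesis mp : measurable_fun (`]0, +oo[%classic : set R) p.
Hypothesis p01 : forall s : R, 0 < s -> 0 <= p s <= 1.
Hypothesis h01 : forall s, 0 <= h s <= 1.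
Hypothesis h_noninc : {homo h : s t / s <= t >-> t <= s}.
Hypothesis renewal : forall t : R, 0 < t ->
  h t + lam * \int[mu]_(s in `[0, t[) (p s * h (t - s)) = 1.

Local Notation pe := (ext p).
Local Notation he := (ext h).

Let nnm_pe : nnm pe.
Proof. by apply: nnm_ext => // s /p01/andP[]. Qed.

Let nnm_he : nnm he.
Proof.
apply: nnm_ext => [|s _]; last by have /andP[] := h01 s.
by apply: nonincreasing_measurable => // x y; exact: h_noninc.
Qed.

Let he_noninc : nonincreasing_gt0 he.
Proof.
move=> x y x0 xy; rewrite !ext_gt0 ?(lt_le_trans x0 xy)// lee_fin.
exact: h_noninc.
Qed.

Let hs := @nnm_heaviside R.

Lemma heaviside_noninc : nonincreasing_gt0 (@heaviside R).
Proof.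
by move=> x y x0 xy; rewrite /heaviside !ext_gt0// (lt_le_trans x0 xy).
Qed.

Let pe_le s : (pe s <= heaviside s)%E.
Proof.
by rewrite /heaviside /ext; case: ifP => // /p01/andP[_]; rewrite lee_fin.
Qed.

Let he_le s : (he s <= heaviside s)%E.
Proof.
by rewrite /heaviside /ext; case: ifP => // _; rewrite lee_fin; case/andP: (h01 s).
Qed.

Lemma conv_heaviside_heaviside (t : R) : 0 < t -> conv (@heaviside R) heaviside t = t%:E.
Proof.
by move=> t0; rewrite {1}heavisideE conv_pw_heaviside// powRr1 ?ltW// divr1.
Qed.

Lemma conv_le_heaviside (f g : R -> \bar R) t : nnm f -> nnm g -> 0 < t ->
  (forall s, f s <= heaviside s)%E -> (forall s, g s <= heaviside s)%E ->
  (conv f g t <= t%:E)%E.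
Proof.
move=> Hf Hg t0 fh gh; rewrite -conv_heaviside_heaviside//.
by apply: le_conv => // s; apply: lee_pmul => //; [exact: Hf.2|exact: Hg.2].
Qed.

Lemma conv_fin (f g : R -> \bar R) t : nnm f -> nnm g -> 0 < t ->
  (forall s, f s <= heaviside s)%E -> (forall s, g s <= heaviside s)%E ->
  conv f g t \is a fin_num.
Proof.
move=> Hf Hg t0 fh gh; rewrite ge0_fin_numE; last exact: (nnm_conv Hf Hg).2.
exact: le_lt_trans (conv_le_heaviside Hf Hg t0 fh gh) (ltry _).
Qed.

(** The [G t] of the overview; [prim] is the corresponding primitive of [h]. As [p] and [h] are at
    most 1, [fine] loses nothing for [t > 0]. *)
Definition trunc_green t : R := fine (conv pe heaviside t).
Definition prim t : R := fine (conv he heaviside t).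

Lemma trunc_greenE t : 0 < t -> conv pe heaviside t = (trunc_green t)%:E.
Proof. by move=> t0; rewrite fineK// conv_fin. Qed.

Lemma primE t : 0 < t -> conv he heaviside t = (prim t)%:E.
Proof. by move=> t0; rewrite fineK// conv_fin. Qed.

Lemma prim_le t : 0 < t -> prim t <= t.
Proof. by move=> t0; rewrite -lee_fin -primE// conv_le_heaviside. Qed.

Lemma trunc_green_ge0 t : 0 <= trunc_green t.
Proof. by rewrite fine_ge0// (nnm_conv nnm_pe hs).2. Qed.

Lemma conv_pe_he t : 0 < t ->
  conv pe he t = (\int[mu]_(s in `[0, t[) (p s * h (t - s)))%:E.
Proof.
move=> t0.
have E : conv pe he t = (\int[mu]_(s in `[0%R, t[) (p s * h (t - s))%:E)%E.
  rewrite -integral_itv_obnd_cbnd; last first.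
    apply: (eq_measurable_fun (fun s => pe s * he (t - s)%R)%E).
      move=> s; rewrite inE/= in_itv/= => /andP[s0 st].
      by rewrite !ext_gt0 ?subr_gt0// EFinM.
    exact: measurable_funTS (nnm_section t nnm_pe nnm_he).1.
  rewrite [RHS]integral_mkcond; apply: eq_integral => s _; rewrite patchE /ext subr_gt0.
  have [s0|s0] := ltP 0 s; last first.
    by rewrite mul0e memNset//= in_itv/= ltNge s0.
  have [st|st] := ltP s t; last first.
    by rewrite mule0 memNset//= in_itv/= [s < t]ltNge st andbF.
  by rewrite mem_set//= in_itv/= s0.
rewrite /Rintegral -E fineK//; exact: conv_fin.
Qed.

(** All terms vanish for [t <= 0], so the renewal equation holds on the whole line and can be used
    inside a convolution. *)
Lemma renewal_ext t : (he t + lam%:E * conv pe he t = heaviside t)%E.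
Proof.
have [t0|t0] := ltP 0 t.
  by rewrite conv_pe_he// /heaviside !ext_gt0// -EFinM -EFinD renewal.
by rewrite /heaviside !ext_le0// add0e conv_ext_le0// mule0.
Qed.

(** Monotonicity gives [h (t - s) >= h t] under the convolution. *)
Lemma renewal_upper t : 0 < t -> h t * (1 + lam * trunc_green t) <= 1.
Proof.
move=> t0; have /andP[ht0 _] := h01 t.
have H : ((h t)%:E * conv pe heaviside t <= conv pe he t)%E.
  rewrite -convZr//; apply: le_conv => //; first exact: nnmZ.
  move=> s; have [s0|s0] := ltP 0 s; last by rewrite ext_le0// !mul0e.
  apply: lee_wpmul2l; first exact: nnm_pe.2.
  have [st|st] := ltP s t; last first.
    by rewrite /heaviside !ext_le0 ?subr_le0// mule0.
  by rewrite /heaviside !ext_gt0 ?subr_gt0// mule1 lee_fin h_noninc// gerBl ltW.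
move: (renewal t0) H; rewrite conv_pe_he// trunc_greenE// -EFinM lee_fin.
set I := Rintegral _ _ _ => E H; have := ler_wpM2l (ltW lam0) H; nra.
Qed.

(* Split the convolution at time [2 * u]: [h (2 * u - s) <= h u] for [s < u],
   while [p s <= k] for [s >= u]. *)
Lemma renewal_lower u k : 0 < u -> 0 <= k -> (forall s, u <= s -> p s <= k) ->
  1 <= h u * (1 + lam * trunc_green u) + lam * (k * prim (2 * u)).
Proof.
move=> u0 k0 pk; have u20 : 0 < 2 * u by rewrite mulr_gt0.
have /andP[hu0 _] := h01 u.
have H : (conv pe he (2 * u) <=
    (h u)%:E * conv pe heaviside u + k%:E * conv heaviside he (2 * u))%E.
  have [m1 p1] := nnm_section u nnm_pe hs.
  have [m2 p2] := nnm_section (2 * u) hs nnm_he.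
  rewrite /conv -(ge0_integralZl mu measurableT m1 (fun s _ => p1 s)) ?lee_fin//.
  rewrite -(ge0_integralZl mu measurableT m2 (fun s _ => p2 s)) ?lee_fin//.
  have [mZ1 pZ1] := nnmZ hu0 (conj m1 p1); have [mZ2 pZ2] := nnmZ k0 (conj m2 p2).
  rewrite -(ge0_integralD mu measurableT (fun s _ => pZ1 s) mZ1 (fun s _ => pZ2 s) mZ2).
  have [m3 p3] := nnm_section (2 * u) nnm_pe nnm_he.
  apply: ge0_le_integral => //; first exact: emeasurable_funD.
  move=> s _; have [s0|s0] := ltP 0 s; last first.
    apply: (@le_trans _ _ 0%E); first by rewrite ext_le0// mul0e.
    by apply: adde_ge0; [exact: pZ1|exact: pZ2].
  have [su|us] := ltP s u.
    apply: (@le_trans _ _ ((h u)%:E * (pe s * heaviside (u - s)%R))%E); last by apply: leeDl; exact: pZ2.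
    have s2u : 0 < 2 * u - s by lra.
    rewrite /heaviside (ext_gt0 _ s2u) [ext _ (u - s)]ext_gt0 ?subr_gt0// mule1 muleC.
    apply: lee_wpmul2r; first exact: nnm_pe.2.
    by rewrite lee_fin h_noninc//; lra.
  apply: (@le_trans _ _ (k%:E * (heaviside s * he (2 * u - s)%R))%E); last by apply: leeDr; exact: pZ1.
  rewrite /heaviside (ext_gt0 _ s0) (ext_gt0 _ s0) mul1e.
  by apply: lee_wpmul2r; [exact: nnm_he.2|rewrite lee_fin pk].
have h2u : h (2 * u) <= h u by rewrite h_noninc//; lra.
move: (renewal u20) H; rewrite conv_pe_he// trunc_greenE// (convC _ hs nnm_he) primE//.
rewrite -!EFinM -EFinD lee_fin; set I := Rintegral _ _ _ => E H.
have := ler_wpM2l (ltW lam0) H; nra.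
Qed.

(** Each half becomes an inequality between sums of convolutions, checked pointwise: the integrands
    agree off [[s, t[], and on it the monotonicity of [h] decides. *)
Lemma prim_increment (s t : R) : 0 < s -> s <= t ->
  h t * (t - s) <= prim t - prim s <= h s * (t - s).
Proof.
move=> s0 st; have t0 := lt_le_trans s0 st.
have /andP[ht0 _] := h01 t; have /andP[hs0 _] := h01 s.
have nZ (a : R) : 0 <= a -> nnm (fun x : R => a%:E * heaviside x)%E.
  by move=> a0; exact: (nnmZ a0 hs).
have Hs := nZ _ hs0; have Ht := nZ _ ht0.
have zero (a r v : R) : r <= 0 -> (he r * heaviside v = 0)%E /\ (heaviside r * (a%:E * heaviside v) = 0)%E.
  by move=> r0; rewrite /heaviside (ext_le0 _ r0) (ext_le0 _ r0) !mul0e.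
have zero' (a r v : R) : v <= 0 -> (he r * heaviside v = 0)%E /\ (heaviside r * (a%:E * heaviside v) = 0)%E.
  by move=> v0; rewrite /heaviside [ext _ v]ext_le0// !mule0.
have one (a r v : R) : 0 < r -> 0 < v -> (he r * heaviside v = (h r)%:E)%E /\
    (heaviside r * (a%:E * heaviside v) = a%:E)%E.
  by move=> r0 v0; rewrite /heaviside !ext_gt0// !mule1 mul1e.
have H1 : (conv he heaviside s + (h t)%:E * conv heaviside heaviside t <=
    conv he heaviside t + (h t)%:E * conv heaviside heaviside s)%E.
  rewrite -!convZr//; apply: le_conv2 => // r.
  have [r0|r0] := ltP 0 r; last first.
    by have [-> ->] := zero (h t) _ (s - r) r0; have [-> ->] := zero (h t) _ (t - r) r0.
  have [rs|sr] := ltP r s.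
    have rt := lt_le_trans rs st.
    have [] := one (h t) r (s - r) r0; first by rewrite subr_gt0.
    move=> -> ->; have [] := one (h t) r (t - r) r0; first by rewrite subr_gt0.
    by move=> -> ->.
  have [] := zero' (h t) r (s - r); first by rewrite subr_le0.
  move=> -> ->; have [rt|tr] := ltP r t; last first.
    have [] := zero' (h t) r (t - r); first by rewrite subr_le0.
    by move=> -> ->.
  have [] := one (h t) r (t - r) r0; first by rewrite subr_gt0.
  by move=> -> ->; rewrite add0e adde0 lee_fin h_noninc// ltW.
have H2 : (conv he heaviside t + (h s)%:E * conv heaviside heaviside s <=
    conv he heaviside s + (h s)%:E * conv heaviside heaviside t)%E.
  rewrite -!convZr//; apply: le_conv2 => // r.
  have [r0|r0] := ltP 0 r; last first.
    by have [-> ->] := zero (h s) _ (s - r) r0; have [-> ->] := zero (h s) _ (t - r) r0.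
  have [rs|sr] := ltP r s.
    have rt := lt_le_trans rs st.
    have [] := one (h s) r (s - r) r0; first by rewrite subr_gt0.
    move=> -> ->; have [] := one (h s) r (t - r) r0; first by rewrite subr_gt0.
    by move=> -> ->.
  have [] := zero' (h s) r (s - r); first by rewrite subr_le0.
  move=> -> ->; have [rt|tr] := ltP r t; last first.
    have [] := zero' (h s) r (t - r); first by rewrite subr_le0.
    by move=> -> ->.
  have [] := one (h s) r (t - r) r0; first by rewrite subr_gt0.
  by move=> -> ->; rewrite add0e adde0 lee_fin h_noninc.
move: H1 H2; rewrite !primE// !conv_heaviside_heaviside// -!EFinM -!EFinD !lee_fin.
by move=> H1 H2; apply/andP; split; rewrite !mulrBr; lra.
Qed.

(** * The three regimes of the exponent *)

Variables (c alpha : R).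
Hypothesis c0 : 0 < c.
Hypothesis alpha0 : 0 < alpha.
Hypothesis p_asymp : asymp_equiv p (fun t => c * t `^ (- alpha)).

Lemma p_bounds (e : R) : 0 < e -> \forall t \near +oo,
  p t <= (1 + e) * (c * t `^ (- alpha)) /\ c * t `^ (- alpha) <= (1 + e) * p t.
Proof.
move=> e0; apply: asymp_bounds p_asymp => //.
near=> t; have t0 : 0 < t by near: t; exact: (nbhs_pinfty_gt (num_real _)).
by rewrite mulr_gt0// powR_gt0.
Unshelve. all: by end_near. Qed.

Lemma p_eqv : eqv pe (fun s => c%:E * pw (1 - alpha) s)%E.
Proof.
move=> e e0; have Hp0 := p_bounds e0; near=> t.
have t0 : 0 < t by near: t; exact: (nbhs_pinfty_gt (num_real _)).
rewrite /pw !(ext_gt0 _ t0) -!EFinM !lee_fin addrAC subrr add0r.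
by near: t.
Unshelve. all: by end_near. Qed.

(** The cut at 1 removes the singularity at 0, where the power is not integrable if [b <= 0], that
    is in the regimes [alpha >= 1]. *)
Definition pw_tail (b s : R) : \bar R := if 1 <= s then (s `^ (b - 1))%:E else 0%E.

Lemma nnm_pw_tail b : nnm (pw_tail b).
Proof.
have -> : pw_tail b = (fun s => (s `^ (b - 1))%:E) \_ `[1, +oo[.
  apply/funext => s; rewrite patchE /pw_tail; case: ifPn => s1.
    by rewrite mem_set/= ?in_itv/= ?s1.
  by rewrite memNset//= in_itv/= andbT; exact/negP.
split; last by move=> s; apply: erestrict_ge0 => r _; rewrite lee_fin powR_ge0.
apply/(measurable_restrictT (fun s => (s `^ (b - 1))%:E)) => //.
by apply: measurable_funTS; apply/measurable_EFinP; exact: measurable_powR.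
Qed.

Lemma conv_pw_tail b t : 1 < t ->
  conv (pw_tail b) heaviside t = (\int[mu]_(s in `[1%R, t]) (s `^ (b - 1))%:E)%E.
Proof.
move=> t1; have Hb := nnm_pw_tail b.
rewrite (conv_heaviside _ Hb) integral_itv_bndo_bndc; last first.
  by apply: measurable_funTS; exact: Hb.1.
rewrite [LHS]integral_mkcond [RHS]integral_mkcond.
apply: eq_integral => s _; rewrite !patchE /pw_tail; have [s1|s1] := leP 1 s.
  by congr (if _ then _ else _); apply/idP/idP; rewrite !inE/= !in_itv/= s1.
by rewrite if_same [in RHS]memNset//= in_itv/=; apply/negP; rewrite leNgt s1.
Qed.

Lemma conv_inv_tail t : 1 < t -> conv (pw_tail 0) heaviside t = (ln t)%:E.
Proof.
move=> t1; rewrite conv_pw_tail// -[RHS](_ : (ln t - ln 1)%:E = _); last by rewrite ln1 subr0.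
rewrite -integral_inv//; apply: eq_integral => s; rewrite inE/= in_itv/= => /andP[s1 _].
by rewrite sub0r powR_inv1// (le_trans _ s1).
Qed.

Lemma pw_tail_le b s : b <= 1 -> (pw_tail b s <= heaviside s)%E.
Proof.
move=> b1; rewrite /pw_tail; case: ifPn => s1; last exact: hs.2.
have s0 : 0 < s by rewrite (lt_le_trans _ s1).
have := pw_nonincreasing b1 (@ltr01 R) s1.
by rewrite /pw /heaviside !ext_gt0// powR1.
Qed.

(** This serves as the smallness hypothesis of [eqv_conv] for the kernel [heaviside]. *)
Lemma heaviside_shift_le (C M : R) (f : R -> R) : (forall K, \forall t \near +oo, K <= f t) ->
  \forall t \near +oo, (C%:E * heaviside (t - M)%R <= (f t)%:E)%E.
Proof.
move=> Hf; have HC := Hf `|C|; near=> t.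
have tM : 0 < t - M by rewrite subr_gt0; near: t; exact: (nbhs_pinfty_gt (num_real _)).
rewrite /heaviside ext_gt0// mule1 lee_fin (le_trans (ler_norm _))//.
by near: t.
Unshelve. all: by end_near. Qed.

Lemma trunc_green_log : alpha = 1 -> eqv (EFin \o trunc_green) (fun t => (c * ln t)%:E).
Proof.
move=> a1.
have cge0 := ltW c0.
have Hc : nnm (fun s => c%:E * pw_tail 0 s)%E by apply: nnmZ => //; exact: nnm_pw_tail.
have convc t : 1 < t -> conv (fun s => c%:E * pw_tail 0 s)%E heaviside t = (c * ln t)%:E.
  by move=> t1; rewrite (convZl _ cge0 (nnm_pw_tail 0) hs) conv_inv_tail.
have gt1 : \forall t \near +oo, 1 < t :> R by exact: (nbhs_pinfty_gt (num_real _)).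
have E : eqv (conv pe heaviside) (conv (fun s => c%:E * pw_tail 0 s)%E heaviside).
  apply: eqv_conv => //.
  - exact: heaviside_noninc.
  - by move=> M M0; exact: conv_fin.
  - move=> M M0; rewrite (convZl _ cge0 (nnm_pw_tail 0) hs) fin_numM//.
    apply: conv_fin => //; [exact: nnm_pw_tail|by move=> s; exact: pw_tail_le].
  - by apply: filterS gt1 => t t1; rewrite convc.
  - move=> C M e e0; have H : forall K : R, \forall t \near +oo, K <= e * (c * ln t).
      move=> K; have := near_ln_ge (K / (e * c)); apply: filterS => t.
      by rewrite ler_pdivrMr ?mulr_gt0// mulrC -mulrA.
    have Hh := heaviside_shift_le C M H; near=> t.
    have t1 : 1 < t by near: t.
    by rewrite convc// -EFinM; near: t.
  - move=> e e0; have Hp0 := p_bounds e0; near=> t.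
    have t1 : 1 < t by near: t.
    have t0 : 0 < t by rewrite (lt_trans _ t1).
    rewrite (ext_gt0 _ t0) /pw_tail (ltW t1) -!EFinM !lee_fin.
    by rewrite sub0r -[X in - X]a1; near: t.
apply: eqv_near E.
  by apply: filterS gt1 => t t1; rewrite /= trunc_greenE// (lt_trans _ t1).
by apply: filterS gt1 => t t1; rewrite convc.
Unshelve. all: by end_near. Qed.

Lemma trunc_green_pow : alpha < 1 -> eqv (EFin \o trunc_green)
  (fun t => (c / (1 - alpha) * t `^ (1 - alpha))%:E).
Proof.
move=> a1; have a10 : 0 < 1 - alpha by rewrite subr_gt0.
have cge0 := ltW c0.
have Hp := nnm_pw (1 - alpha).
have Hc : nnm (fun s => c%:E * pw (1 - alpha) s)%E by exact: nnmZ.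
have convc t : 0 < t -> conv (fun s => c%:E * pw (1 - alpha) s)%E heaviside t =
    (c / (1 - alpha) * t `^ (1 - alpha))%:E.
  move=> t0; rewrite (convZl _ cge0 Hp hs) conv_pw_heaviside// -EFinM.
  by congr EFin; rewrite mulrA mulrAC.
have gt0 : \forall t \near +oo, 0 < t :> R by exact: (nbhs_pinfty_gt (num_real _)).
have E : eqv (conv pe heaviside) (conv (fun s => c%:E * pw (1 - alpha) s)%E heaviside).
  apply: eqv_conv => //.
  - exact: heaviside_noninc.
  - by move=> M M0; exact: conv_fin.
  - by move=> M M0; rewrite convc.
  - by apply: filterS gt0 => t t0; rewrite convc.
  - move=> C M e e0.
    have H : forall K : R, \forall t \near +oo, K <= e * (c / (1 - alpha) * t `^ (1 - alpha)).
      move=> K; have := near_powR_ge (K / (e * (c / (1 - alpha)))) a10; apply: filterS => t.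
      by rewrite ler_pdivrMr; [rewrite mulrC -(mulrA e)|rewrite mulr_gt0// divr_gt0].
    have Hh := heaviside_shift_le C M H; near=> t.
    have t0 : 0 < t by near: t.
    by rewrite convc// -EFinM; near: t.
  - exact: p_eqv.
apply: eqv_near E.
  by apply: filterS gt0 => t t0; rewrite /= trunc_greenE.
by apply: filterS gt0 => t t0; rewrite convc.
Unshelve. all: by end_near. Qed.

Lemma trunc_green_unbounded (K : R) : alpha <= 1 -> \forall t \near +oo, K <= trunc_green t.
Proof.
rewrite le_eqVlt => /predU1P[a1|a1].
- have /eqv_EFin/(_ 1 ltr01) H := trunc_green_log a1.
  have Hl := near_ln_ge (K * 2 / c).
  near=> t.
  have [_ h1] : trunc_green t <= (1 + 1) * (c * ln t) /\ c * ln t <= (1 + 1) * trunc_green t by near: t.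
  have h2 : K * 2 <= c * ln t by rewrite -ler_pdivrMl// mulrC; near: t.
  by lra.
- have /eqv_EFin/(_ 1 ltr01) H := trunc_green_pow a1.
  have a10 : 0 < 1 - alpha by rewrite subr_gt0.
  have Hl := near_powR_ge (K * 2 / (c / (1 - alpha))) a10.
  have ca0 : 0 < c / (1 - alpha) by rewrite divr_gt0.
  near=> t.
  have [_ h1] : trunc_green t <= (1 + 1) * (c / (1 - alpha) * t `^ (1 - alpha)) /\
     c / (1 - alpha) * t `^ (1 - alpha) <= (1 + 1) * trunc_green t by near: t.
  have h2 : K * 2 <= c / (1 - alpha) * t `^ (1 - alpha).
    by rewrite -ler_pdivrMl// mulrC; near: t.
  by lra.
Unshelve. all: by end_near. Qed.

Lemma h_to0 (e : R) : alpha <= 1 -> 0 < e -> \forall t \near +oo, h t <= e.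
Proof.
move=> a1 e0; have H := trunc_green_unbounded (lam^-1 * e^-1) a1.
near=> t.
have t0 : 0 < t by near: t; exact: (nbhs_pinfty_gt (num_real _)).
have h1 : lam^-1 * e^-1 <= trunc_green t by near: t.
have := renewal_upper t0; have /andP[ht0 _] := h01 t.
rewrite ler_pdivrMl// in h1.
have : h t * e^-1 <= h t * (1 + lam * trunc_green t) by rewrite ler_wpM2l// (le_trans h1)// lerDr.
by move=> /le_trans /[apply]; rewrite ler_pdivrMr// mul1r.
Unshelve. all: by end_near. Qed.

(** Cesaro means of a function tending to 0: half of [e] bounds [h] beyond [M], the other half
    absorbs [prim M]. *)
Lemma prim_small (e : R) : alpha <= 1 -> 0 < e -> \forall t \near +oo, prim t <= e * t.
Proof.
move=> a1 e0; have e20 : 0 < e / 2 by rewrite divr_gt0.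
have [M0 [_ HM0]] := h_to0 a1 e20.
pose M := Num.max M0 0 + 1.
have M0' : 0 < M by rewrite ltr_wpDl// le_max lexx orbT.
have HM s : M <= s -> h s <= e / 2.
  by move=> Ms; apply: HM0; rewrite (lt_le_trans _ Ms)// ltr_pwDr// le_max lexx.
near=> t.
have Mt : M < t by near: t; exact: (nbhs_pinfty_gt (num_real _)).
have t0 : 0 < t by exact: lt_trans Mt.
have := @conv_comparison _ he (fun s => (e / 2)%:E * heaviside s)%E heaviside M t
  nnm_he (nnmZ (ltW e20) hs) hs heaviside_noninc _ Mt.
rewrite (convZl _ (ltW e20) hs hs) conv_heaviside_heaviside// !primE//.
rewrite (_ : heaviside (t - M) = 1%E); last by rewrite /heaviside ext_gt0 ?subr_gt0.
rewrite mule1 -EFinM -EFinD lee_fin => H.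
apply: le_trans (H _) _.
  move=> s Ms; have s0 : 0 < s by exact: lt_le_trans Ms.
  by rewrite /heaviside !ext_gt0// mule1 lee_fin HM.
have : prim M <= e / 2 * t.
  by rewrite -ler_pdivrMl//; near: t; exact: (nbhs_pinfty_ge (num_real _)).
by lra.
Unshelve. all: by end_near. Qed.

(** [renewal_lower] with [k = 2 c u^(-alpha)], the 2 coming from [p_bounds] at error 1. The
    remainder has the order of [u^(-alpha) * prim (2 u)]: for [alpha > 1] the bound
    [prim (2 u) <= 2 u] is enough, while [alpha = 1] calls for [prim_small]. *)
Lemma h_trunc_green_lower (e : R) : 1 <= alpha -> 0 < e ->
  \forall u \near +oo, 1 - e <= h u * (1 + lam * trunc_green u).
Proof.
move=> a1 e0.
suff H : \forall u \near +oo, lam * (2 * c * u `^ (- alpha) * prim (2 * u)) <= e.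
  have /(_ 1 ltr01)[M [_ HM]] := p_bounds; near=> u.
  have u0 : 0 < u by near: u; exact: (nbhs_pinfty_gt (num_real _)).
  have Mu : M < u by near: u; exact: (nbhs_pinfty_gt (num_real _)).
  have k0 : 0 <= 2 * c * u `^ (- alpha) by rewrite !mulr_ge0 ?powR_ge0// ltW.
  have := renewal_lower u0 k0.
  have pk s : u <= s -> p s <= 2 * c * u `^ (- alpha).
    move=> us; have [+ _] := HM s (lt_le_trans Mu us).
    move=> /le_trans; apply; rewrite -mulrA ler_pM2l// ler_pM2l//.
    rewrite !powRN lef_pV2 ?posrE ?powR_gt0// ?(lt_le_trans u0)//.
    by apply: ge0_ler_powR; rewrite ?nnegrE ?(ltW alpha0) ?(ltW u0)// (le_trans (ltW u0)).
  move=> /(_ pk) L; have : lam * (2 * c * u `^ (- alpha) * prim (2 * u)) <= e by near: u.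
  by lra.
move: a1; rewrite le_eqVlt => /predU1P[a1|a1].
(* The 4 is the 2 in [k] times the 2 in [prim (2 * u)]. *)
- have k0 : 0 < e / (4 * c * lam) by rewrite divr_gt0// !mulr_gt0.
  have al1 : alpha <= 1 by rewrite -a1.
  have H := near_scale (@ltr0Sn R 1) (prim_small al1 k0); near=> u.
  have u0 : 0 < u by near: u; exact: (nbhs_pinfty_gt (num_real _)).
  have h1 : prim (2 * u) <= e / (4 * c * lam) * (2 * u) by near: u.
  rewrite -a1 powR_inv1 ?(ltW u0)//.
  have k1 : 0 < lam * (2 * c * u^-1) by rewrite !mulr_gt0// invr_gt0.
  rewrite mulrA; apply: le_trans (ler_wpM2l (ltW k1) h1) _.
  rewrite le_eqVlt; apply/orP; left; apply/eqP; field.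
  by rewrite !gt_eqF.
- have a10 : 0 < alpha - 1 by rewrite subr_gt0.
  have k0 : 0 < e / (4 * c * lam) by rewrite divr_gt0// !mulr_gt0.
  have H := near_powR_le a10 k0; near=> u.
  have u0 : 0 < u by near: u; exact: (nbhs_pinfty_gt (num_real _)).
  have h1 : u `^ (- (alpha - 1)) <= e / (4 * c * lam) by near: u.
  have h2 := prim_le (mulr_gt0 (@ltr0Sn R 1) u0).
  have h3 : u `^ (- (alpha - 1)) = u `^ (- alpha) * u.
    rewrite opprB addrC powRD ?powRr1 ?(ltW u0)//.
    by apply/implyP => _; rewrite gt_eqF.
  move: h1; rewrite h3 ler_pdivlMr ?mulr_gt0// => h1.
  have pu : 0 < u `^ (- alpha) by rewrite powR_gt0.
  apply: le_trans h1; rewrite [leRHS](_ : _ = lam * (2 * c * u `^ (- alpha) * (2 * u))); last by ring.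
  by rewrite ler_pM2l// ler_pM2l// !mulr_gt0.
Unshelve. all: by end_near. Qed.

Lemma asymp_critical : alpha = 1 ->
  asymp_equiv h (fun t => 1 / ln t * (1 / (lam * c))).
Proof.
move=> a1; have lc0 : 0 < lam * c by rewrite mulr_gt0.
have lnt : \forall t \near +oo, 0 < ln t :> R.
  by have := near_ln_ge (1 : R); apply: filterS => t; exact: lt_le_trans.
apply: asymp_intro.
  by apply: filterS lnt => t lt0; rewrite mulr_gt0// divr_gt0.
(* One third each for the lower bound on [h (1 + lam G)], for replacing [G] by [c ln t], and for the
   summand 1 next to [lam G]. *)
move=> e e0; have e10 : 0 < e / 3 by rewrite divr_gt0.
have a1' : 1 <= alpha by rewrite a1.
have /eqv_EFin/(_ _ e10) HG := trunc_green_log a1.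
have HL := h_trunc_green_lower a1' e10.
have Hl := near_ln_ge ((e / 3)^-1 / (lam * c)).
near=> t.
have t0 : 0 < t by near: t; exact: (nbhs_pinfty_gt (num_real _)).
have l0 : 0 < ln t by near: t.
have Z0 : 0 < lam * c * ln t by rewrite mulr_gt0.
have -> : 1 / ln t * (1 / (lam * c)) = (lam * c * ln t)^-1.
  by rewrite !div1r -invfM mulrC.
have [g1 g2] : trunc_green t <= (1 + e / 3) * (c * ln t) /\ c * ln t <= (1 + e / 3) * trunc_green t by near: t.
have hl : 1 - e / 3 <= h t * (1 + lam * trunc_green t) by near: t.
have hu := renewal_upper t0; have /andP[ht0 _] := h01 t.
have z1 : 1 <= e / 3 * (lam * c * ln t).
  by rewrite mulrC -ler_pdivrMr// div1r -ler_pdivrMl// mulrC; near: t.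
rewrite ler_pdivrMr// ler_pdivlMr//.
have g1' := ler_wpM2l (ltW lam0) g1; have g2' := ler_wpM2l (ltW lam0) g2.
set Z := lam * c * ln t in Z0 z1 *.
have ZE : lam * (c * ln t) = Z by rewrite /Z mulrA.
have lg0 : 0 <= lam * trunc_green t by rewrite mulr_ge0 ?trunc_green_ge0// ltW.
have u1 : 1 + lam * trunc_green t <= (1 + 2 * (e / 3)) * Z by nra.
have u2 : Z <= (1 + e / 3) * (lam * trunc_green t) by nra.
have v1 := ler_wpM2l ht0 u1; have v2 := ler_wpM2l ht0 u2.
have e3 : e = 3 * (e / 3) by field.
apply/andP; rewrite e3; move: (e / 3) e10 hl v1 v2 => d d0 hl v1 v2.
split; nra.
Unshelve. all: by end_near. Qed.

Lemma asymp_supercritical (g : R) : 1 < alpha -> 0 <= g ->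
  trunc_green t @[t --> +oo] --> g -> asymp_equiv h (fun=> 1 / (lam * g + 1)).
Proof.
move=> a1 g0 Gg; have lg0 : 0 < lam * g + 1 by rewrite ltr_wpDl// mulr_ge0// ltW.
have H1 : h t * (1 + lam * trunc_green t) @[t --> +oo] --> (1 : R).
  apply/cvgrPdist_le => e e0; have HL := h_trunc_green_lower (ltW a1) e0; near=> t.
  have t0 : 0 < t by near: t; exact: (nbhs_pinfty_gt (num_real _)).
  have hl : 1 - e <= h t * (1 + lam * trunc_green t) by near: t.
  by rewrite ler_distlC hl (le_trans (renewal_upper t0))// lerDl ltW.
have H2 : (lam * g + 1) / (1 + lam * trunc_green t) @[t --> +oo] --> (1 : R).
  rewrite -[X in _ --> X](divff (lt0r_neq0 lg0)); apply: cvgM; first exact: cvg_cst.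
  apply: cvgV; first exact: lt0r_neq0.
  rewrite addrC; apply: cvgD; first exact: cvg_cst.
  by apply: cvgM; [exact: cvg_cst|exact: Gg].
rewrite /asymp_equiv -[X in _ --> X]mulr1.
have -> : (fun t => h t / (1 / (lam * g + 1))) =
    (fun t => h t * (1 + lam * trunc_green t) * ((lam * g + 1) / (1 + lam * trunc_green t))).
  apply/funext => t; rewrite div1r invrK; field.
  by rewrite gt_eqF// ltr_pwDl// mulr_ge0 ?trunc_green_ge0// ltW.
exact: cvgM H1 H2.
Unshelve. all: by end_near. Qed.

(** Beyond [M] the function [p] lies below the integrable tail [2 c s^(-alpha)]; up to [M], [p <= 1]
    bounds the integral by [M]. *)
Lemma trunc_green_bounded : 1 < alpha -> exists B : R, forall t, 0 < t -> trunc_green t <= B.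
Proof.
move=> a1; have a10 : 0 < alpha - 1 by rewrite subr_gt0.
have [M0 [_ HM0]] := p_bounds (@ltr01 R).
(* [M > 1], so that [pw_tail] is the full power beyond [M]. *)
pose M := Num.max M0 1 + 1.
have M1 : 1 < M by rewrite ltr_pwDr// le_max lexx orbT.
have M0' : 0 < M by exact: lt_trans M1.
have HM s : M <= s -> p s <= 2 * c * s `^ (- alpha).
  move=> Ms; have M0s : M0 < s by rewrite (lt_le_trans _ Ms)// ltr_pwDr// le_max lexx.
  by have [+ _] := HM0 s M0s; rewrite mulrA.
have k0 : 0 <= 2 * c by rewrite mulr_ge0// ltW.
have Ht := nnm_pw_tail (1 - alpha).
have main t : M < t -> trunc_green t <= 2 * c / (alpha - 1) + trunc_green M.
  move=> Mt; have t1 := lt_trans M1 Mt; have t0 := lt_trans M0' Mt.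
  have := @conv_comparison _ pe (fun s => (2 * c)%:E * pw_tail (1 - alpha) s)%E
    heaviside M t nnm_pe (nnmZ k0 Ht) hs heaviside_noninc _ Mt.
  rewrite (convZl _ k0 Ht hs) conv_pw_tail// integral_powR//; last first.
    by rewrite subr_eq0 lt_eqF.
  rewrite !trunc_greenE// (_ : heaviside (t - M) = 1%E); last by rewrite /heaviside ext_gt0 ?subr_gt0.
  rewrite mule1 -EFinM -EFinD lee_fin => H; apply: le_trans (H _) _.
    move=> s Ms; have s0 := lt_le_trans M0' Ms.
    rewrite (ext_gt0 _ s0) /pw_tail (le_trans (ltW M1) Ms) -EFinM lee_fin.
    by rewrite addrAC subrr add0r HM.
  rewrite lerD2r; apply: ler_wpM2l => //.
  rewrite powR1 -opprB -(opprB alpha) invrN mulrN mulNr opprK.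
  rewrite ler_pdivrMr// mulVf ?gt_eqF// lerBlDr lerDl.
  exact: powR_ge0.
exists (Num.max (2 * c / (alpha - 1) + trunc_green M) M) => t t0.
rewrite le_max; have [Mt|tM] := ltP M t; first by rewrite main.
apply/orP; right; rewrite -lee_fin -trunc_greenE//.
by rewrite (le_trans (conv_le_heaviside _ _ _ _ _))// lee_fin.
Qed.

(** Boundedness makes the integral finite, so its [fine] is the true value. Monotone convergence
    gives the limit along the integers, and monotonicity of [trunc_green] extends it to real [t]. *)
Lemma trunc_green_cvg : 1 < alpha -> trunc_green t @[t --> +oo] --> fine (\int[mu]_s pe s)%E.
Proof.
move=> a1; have [B HB] := trunc_green_bounded a1; set I := (\int[mu]_s pe s)%E.
have [mpe pe0] := nnm_pe.
pose F (n : nat) : set R := `]-oo, n.+1%:R[%classic.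
have UF : \bigcup_n F n = setT.
  apply/seteqP; split => // s _; exists (Num.truncn s) => //.
  by rewrite /F /= in_itv/= truncnS_gt.
have ndF : nondecreasing_seq F.
  move=> m n mn; apply/subsetPset => s; rewrite /F /= !in_itv/= => /lt_le_trans; apply.
  by rewrite ler_nat.
have mF n : measurable_fun (F n) pe by exact: measurable_funTS.
have H := @ge0_nondecreasing_set_cvg_integral _ (measurableTypeR R) R F pe mu ndF
  (fun n => measurable_itv _) mF (fun n x _ => pe0 x).
have E : (fun n => \int[mu]_(x in F n) pe x)%E = (fun n => (trunc_green n.+1%:R)%:E).
  by apply/funext => n; rewrite -trunc_greenE// conv_heaviside.
rewrite UF E -/I in H.
have IB : (I <= B%:E)%E.
  rewrite -(cvg_lim _ H)//; apply: lime_le; first by apply/cvg_ex; exists I.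
  by apply: nearW => n; rewrite lee_fin HB.
have I0 : (0 <= I)%E by exact: integral_ge0.
have If : I \is a fin_num by rewrite ge0_fin_numE// (le_lt_trans IB)// ltry.
have Gle t : 0 < t -> trunc_green t <= fine I.
  move=> t0; rewrite -lee_fin -trunc_greenE// fineK// conv_heaviside//.
  by apply: ge0_subset_integral => // x _; exact: pe0.
have Gmono s t : 0 < s -> s <= t -> trunc_green s <= trunc_green t.
  move=> s0 st; have t0 := lt_le_trans s0 st.
  rewrite -lee_fin -!trunc_greenE// !conv_heaviside//.
  apply: ge0_subset_integral => //; first exact: measurable_funTS.
  by move=> r; rewrite /= !in_itv/= => /lt_le_trans; apply.
have {}H : trunc_green n.+1%:R @[n --> \oo] --> fine I.
  have H' : (trunc_green n.+1%:R)%:E @[n --> \oo] --> (fine I)%:E by rewrite fineK.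
  exact: (fine_cvg H').
apply/cvgrPdist_le => e e0; have /cvgrPdist_le/(_ _ e0)[N _ HN] := H.
near=> t.
have Nt : N.+1%:R <= t by near: t; exact: (nbhs_pinfty_ge (num_real _)).
have t0 : 0 < t by exact: lt_le_trans Nt.
have h1 := Gle t t0; have h2 := Gmono _ _ (ltr0Sn R N) Nt.
have /= := HN N (leqnn N); rewrite !ger0_norm ?subr_ge0// ?Gle//.
by apply: le_trans; rewrite lerD2l lerN2.
Unshelve. all: by end_near. Qed.

(* Convolving [1 - h = lam * (p * h)] with [q s = s `^ (alpha - 1)]: the left side
   is equivalent to [t `^ alpha / alpha] since [h] vanishes at infinity, and
   [p * q] tends to [c * B (alpha, 1 - alpha)], which yields the primitive of [h]. *)
Let q := pw alpha.
Let Hq : nnm q := nnm_pw alpha.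

Lemma asymp_subcritical (a1 : alpha < 1) :
  asymp_equiv h (fun t => 1 / t `^ (1 - alpha) *
    (1 / (lam * c * fine (beta_reflect alpha)))).
Proof.
have a10 : 0 < 1 - alpha by rewrite subr_gt0.
have a01 : 0 < alpha < 1 by rewrite alpha0.
set D := fine (beta_reflect alpha).
have DE : beta_reflect alpha = D%:E by rewrite /D fineK// beta_reflect_fin.
have D0 : 0 < D by rewrite (@lt_le_trans _ _ 1)// -lee_fin -DE beta_reflect_ge1.
have cD0 : 0 < c * D by rewrite mulr_gt0.
have gt0 : \forall t \near +oo, 0 < t :> R by exact: (nbhs_pinfty_gt (num_real _)).
have qd : nonincreasing_gt0 q by exact: pw_nonincreasing (ltW a1).
pose r s := (c%:E * pw (1 - alpha) s)%E.
have Hr : nnm r by apply: nnmZ; [exact: ltW|exact: nnm_pw].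
have Hpe := nnm_pe; have Hhe := nnm_he.
have Hphi : nnm (conv pe q) by exact: nnm_conv.
have Hpsi : nnm (conv pe he) by exact: nnm_conv.
(* The exponents of [r] and [q] are complementary, so the scaling factor of their convolution is
   [t^0]. *)
have rq t : 0 < t -> conv r q t = (c * D)%:E.
  move=> t0; rewrite (convZl _ (ltW c0) (nnm_pw _) Hq) (convC _ (nnm_pw _) Hq).
  by rewrite conv_pw_reflect// DE.
have q_small (C M e : R) : 0 < e -> \forall t \near +oo, (C%:E * q (t - M)%R <= e%:E)%E.
  move=> e0; have k0 : 0 < e / (`|C| + 1) by rewrite divr_gt0// ltr_wpDl.
  have H := near_shift M (near_powR_le a10 k0); near=> t.
  have tM : 0 < t - M by rewrite subr_gt0; near: t; exact: (nbhs_pinfty_gt (num_real _)).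
  have h1 : (t - M) `^ (- (1 - alpha)) <= e / (`|C| + 1) by near: t.
  rewrite /q /pw ext_gt0// -EFinM lee_fin.
  rewrite -[alpha - 1]opprB -[leRHS](divfK (_ : `|C| + 1 != 0)) ?gt_eqF ?ltr_wpDl//.
  rewrite [leRHS]mulrC; apply: le_trans (ler_wpM2r (powR_ge0 _ _) (ler_norm C)) _.
  by apply: ler_pM => //; rewrite ?powR_ge0// lerDl.
have S1 : eqv (conv pe q) (fun t => (c * D)%:E * heaviside t)%E.
  have : eqv (conv pe q) (conv r q).
    apply: eqv_conv => //.
    - by move=> M M0; exact: conv_fin.
    - move=> M M0; rewrite (convZl _ (ltW c0) (nnm_pw _) hs) conv_pw_heaviside//.
    - by apply: filterS gt0 => t t0; rewrite rq.
    - move=> C M e e0; have H := q_small C M _ (mulr_gt0 e0 cD0); near=> t.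
      have t0 : 0 < t by near: t.
      by rewrite rq// -EFinM; near: t.
    - exact: p_eqv.
  apply: eqv_near; first exact: nearW.
  by apply: filterS gt0 => t t0; rewrite rq// /heaviside ext_gt0// mule1.
have uq t : 0 < t -> conv heaviside q t = (t `^ alpha / alpha)%:E.
  by move=> t0; rewrite (convC _ hs Hq) conv_pw_heaviside.
have S2 : eqv (conv (fun s => lam%:E * conv pe he s)%E q) (fun t => (t `^ alpha / alpha)%:E).
  have : eqv (conv (fun s => lam%:E * conv pe he s)%E q) (conv heaviside q).
    have Hl := nnmZ (ltW lam0) Hpsi.
    apply: eqv_conv => //.
    - move=> M M0; apply: conv_fin => // s; rewrite -renewal_ext leeDr//.
      exact: Hhe.2.
    - by move=> M M0; exact: conv_fin.
    - by apply: filterS gt0 => t t0; rewrite uq.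
    - move=> C M e e0; have H := q_small C M _ e0.
      have Ha := near_powR_ge alpha alpha0; near=> t.
      have t0 : 0 < t by near: t.
      have h1 : alpha <= t `^ alpha by near: t.
      apply: (@le_trans _ _ e%:E); first by near: t.
      by rewrite uq// -EFinM lee_fin ler_pMr// ler_pdivlMr// mul1r.
    (* [h <= e / (1 + e)] amounts to [1 <= (1 + e) (1 - h)]. *)
    - move=> e e0; have k0 : 0 < e / (1 + e) by rewrite divr_gt0// addr_gt0.
      have H := h_to0 (ltW a1) k0; near=> t.
      have t0 : 0 < t by near: t.
      have h1 : h t <= e / (1 + e) by near: t.
      have := renewal_ext t; rewrite /heaviside !ext_gt0//.
      rewrite conv_pe_he// -!EFinM -EFinD => -[].
      move: h1; rewrite ler_pdivlMr ?addr_gt0//; move: (lam * _) => x h1 h2.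
      have /andP[h3 h4] := h01 t.
      by split; rewrite lee_fin; nra.
  apply: eqv_near; first exact: nearW.
  by apply: filterS gt0 => t t0; rewrite uq.
(* Exchanging [q] and [h] is what brings the asymptotics of [p * q] into play. *)
have psiq t : conv (conv pe q) he t = conv (conv pe he) q t.
  rewrite -(convA _ Hpe Hq Hhe) -(convA _ Hpe Hhe Hq).
  suff -> : conv q he = conv he q by [].
  by apply/funext => s; exact: convC.
have S2' : eqv (fun t => lam%:E * conv (conv pe q) he t)%E (fun t => (t `^ alpha / alpha)%:E).
  apply: eqv_near S2; last exact: nearW.
  by apply: nearW => t; rewrite (convZl _ (ltW lam0) Hpsi Hq) psiq.
have finphi : \forall t \near +oo, conv (conv pe q) he t \is a fin_num.
  have H := S2' 1 ltr01; near=> t.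
  have [h1 _] : (lam%:E * conv (conv pe q) he t <= (1 + 1)%:E * (t `^ alpha / alpha)%:E)%E /\
   ((t `^ alpha / alpha)%:E <= (1 + 1)%:E * (lam%:E * conv (conv pe q) he t))%E.
    by near: t.
  have p0 : (0 <= conv (conv pe q) he t)%E by exact: (nnm_conv Hphi Hhe).2.
  rewrite ge0_fin_numE//; move: h1 p0; case: (conv _ _ t) => [x| |] //=.
    by rewrite ltry.
  by rewrite gt0_muley// -EFinM.
(* Now [h] is the monotone kernel in [eqv_conv], and [p * q] is exchanged for [c * D] times the
   Heaviside function. *)
have S3 : eqv (fun t => (c * D)%:E * conv he heaviside t)%E (conv (conv pe q) he).
  have HcD := nnmZ (ltW cD0) hs.
  have : eqv (conv (fun t => (c * D)%:E * heaviside t)%E he) (conv (conv pe q) he).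
    apply: eqv_conv => //.
    - by move=> M M0; rewrite (convZl _ (ltW cD0) hs hs) fin_numM//; exact: conv_fin.
    (* Up to time [M], [p <= 1] and the primitive of [q] is at most [M^alpha / alpha]. *)
    - move=> M M0; rewrite -(convA _ Hpe Hq hs).
      have Hqh := nnm_conv Hq hs.
      have k0 : 0 <= M `^ alpha / alpha by rewrite divr_ge0 ?powR_ge0// ltW.
      rewrite ge0_fin_numE; last exact: (nnm_conv Hpe Hqh).2.
      apply: (@le_lt_trans _ _ (conv heaviside
          (fun s => (M `^ alpha / alpha)%:E * heaviside s)%E M)); last first.
        by rewrite (convZr _ k0 hs hs) conv_heaviside_heaviside// -EFinM ltry.
      apply: le_conv => //; first exact: nnmZ.
      move=> s; have [s0|s0] := ltP 0 s; last first.
        rewrite ext_le0// mul0e; apply: mule_ge0; first exact: hs.2.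
        by apply: mule_ge0; [rewrite lee_fin|exact: hs.2].
      apply: lee_pmul; [exact: Hpe.2|exact: Hqh.2|exact: pe_le|].
      have [Ms|sM] := leP (M - s) 0.
        by rewrite conv_ext_le0// mule_ge0//; exact: hs.2.
      rewrite conv_pw_heaviside// /heaviside ext_gt0// mule1 lee_fin.
      rewrite ler_pM2r ?invr_gt0//.
      by apply: ge0_ler_powR; rewrite ?nnegrE ?(ltW sM) ?(ltW M0) ?(ltW alpha0)// gerBl ltW.
    (* [h] is bounded by 1, while the convolution grows at least like a multiple of [t^alpha] by
       [S2']. *)
    - move=> C M e e0; have H := S2' 1 ltr01.
      have Ha := near_powR_ge (2 * `|C| * lam * alpha / e) alpha0; near=> t.
      have t0 : 0 < t by near: t.
      have tM : 0 < t - M by rewrite subr_gt0; near: t; exact: (nbhs_pinfty_gt (num_real _)).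
      have h1 : 2 * `|C| * lam * alpha / e <= t `^ alpha by near: t.
      have [_ h2] : (lam%:E * conv (conv pe q) he t <= (1 + 1)%:E * (t `^ alpha / alpha)%:E)%E /\
       ((t `^ alpha / alpha)%:E <= (1 + 1)%:E * (lam%:E * conv (conv pe q) he t))%E.
        by near: t.
      have finp : conv (conv pe q) he t \is a fin_num by near: t.
      rewrite (ext_gt0 _ tM); have /andP[h3 h4] := h01 (t - M).
      move: h2; rewrite -(fineK finp) -!EFinM !lee_fin; move: (fine _) => x.
      rewrite ler_pdivrMr// => h2; move: h1; rewrite ler_pdivrMr// => h1.
      have h5 : C * h (t - M) <= `|C|.
        by rewrite (le_trans (ler_norm _))// normrM ler_piMr// ger0_norm.
      apply: le_trans h5 _; have la : 0 < lam * alpha by rewrite mulr_gt0.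
      by rewrite -(ler_pM2l la); nra.
    - exact: eqv_sym.
  apply: eqv_near; last exact: nearW.
  by apply: nearW => t; rewrite (convZl _ (ltW cD0) hs Hhe) (convC _ hs Hhe).
(* Differentiating [K * t^alpha] produces the constant [alpha * K = 1 / (lam * c * D)]. *)
pose K := (alpha * (lam * (c * D)))^-1.
have K0 : 0 < K by rewrite invr_gt0 !mulr_gt0.
have SA : eqv (EFin \o prim) (fun t => (K * t `^ alpha)%:E).
  have nA t : (0 <= conv he heaviside t)%E by exact: (nnm_conv Hhe hs).2.
  have nT t : (0 <= (t `^ alpha / alpha)%:E)%E by rewrite lee_fin divr_ge0 ?powR_ge0// ltW.
  have S4 := eqvZ (ltW lam0) S3.
  have S5 : eqv (fun t => lam%:E * ((c * D)%:E * conv he heaviside t))%E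
      (fun t => (t `^ alpha / alpha)%:E).
    apply: eqv_trans S4 S2' => // t.
    by rewrite mule_ge0 ?lee_fin ?(ltW lam0)// mule_ge0// lee_fin ltW.
  have k0 : 0 <= (lam * (c * D))^-1 by rewrite invr_ge0 ltW// mulr_gt0.
  apply: eqv_near (eqvZ k0 S5).
    apply: filterS gt0 => t t0; rewrite primE// -!EFinM /=; congr EFin.
    by field; rewrite !gt_eqF.
  apply: filterS gt0 => t t0; rewrite -!EFinM; congr EFin.
  by rewrite /K; field; rewrite !gt_eqF.
have L := monotone_density K0 alpha0 prim_increment (proj1 (eqv_EFin _ (fun t => K * t `^ alpha)) SA).
suff -> : (fun t => 1 / t `^ (1 - alpha) * (1 / (lam * c * D))) =
  (fun t => alpha * K * t `^ (alpha - 1)) by [].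
apply/funext => t; rewrite -(opprB alpha 1) powRN div1r invrK mulrC; congr (_ * _).
rewrite /K div1r; field.
by rewrite !gt_eqF.
Unshelve. all: by end_near. Qed.

End renewal_asymptotics.

Theorem proposition3p13 (R : realType) (d : measure_display)
    (Omega : measurableType d) (S : countType)
    (P : S -> probability Omega R) (X : R -> Omega -> S)
    (i : S) (c alpha kappa : R) :
  markov_process P X ->
  0 < c -> 0 < alpha ->
  asymp_equiv (fun t => transition_prob P X t i i)
              (fun t => c * t `^ (- alpha)) ->
  kappa < 0 ->
  let E := fun t : R =>
    fine ('E_(P i)[fun w => expR (kappa * local_time X i t w)])%E in
  [/\ alpha < 1 ->
        asymp_equiv E (fun t => 1 / t `^ (1 - alpha) *
          (1 / (- kappa * c * Gamma (1 - alpha) * Gamma alpha))),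
      alpha = 1 ->
        asymp_equiv E (fun t => 1 / ln t * (1 / (- kappa * c))) &
      1 < alpha ->
        asymp_equiv E (fun=> 1 / (- kappa * fine (green P X i) + 1))].
Proof.
move=> HX c0 alpha0 p_asymp kappa0 E.
have -> : E = occupation_transform P X i kappa.
  by apply/funext => t; rewrite /E unlock.
have lam0 : 0 < - kappa by rewrite oppr_gt0.
set h := occupation_transform P X i kappa.
set p := return_prob P X i.
have mp : measurable_fun (`]0, +oo[%classic : set R) p.
  apply: measurable_funS (measurable_return_prob i HX) => //.
  by apply: subset_itvr; rewrite bnd_simp.
have p01 (s : R) : 0 < s -> 0 <= p s <= 1.
  by move=> s0; exact: (return_prob01 i HX (ltW s0)).
have h01 (s : R) : 0 <= h s <= 1 by exact: occupation_transform01.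
have hd : {homo h : s t / s <= t >-> t <= s} by exact: occupation_transform_nonincreasing.
have ren (t : R) : 0 < t ->
    h t + - kappa * \int[lebesgue_measure]_(s in `[0, t[) (p s * h (t - s)) = 1.
  by move=> t0; rewrite mulNr; exact: renewal_equation.
split=> a1.
- have := asymp_subcritical lam0 mp p01 h01 hd ren c0 alpha0 p_asymp a1.
  by rewrite -Gamma_reflect ?alpha0// mulrA.
- exact: (asymp_critical lam0 mp p01 h01 hd ren c0 alpha0 p_asymp a1).
(* [green] includes the endpoint 0, which [ext] drops; a point has measure zero. *)
- have greenE : green P X i = (\int[lebesgue_measure]_s ext p s)%E.
    rewrite /green -integral_itv_obnd_cbnd; last exact/measurable_EFinP.
    rewrite integral_mkcond; apply: eq_integral => s _.
    rewrite patchE /ext; case: ifPn => s0.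
      by rewrite inE/= in_itv/= andbT in s0; rewrite s0.
    rewrite ifF//; apply/negbTE/negP => s1; move/negP : s0; apply.
    by rewrite inE/= in_itv/= s1.
  rewrite greenE.
  apply: (asymp_supercritical lam0 mp p01 h01 hd ren c0 alpha0 p_asymp a1).
    apply: fine_ge0; apply: integral_ge0 => s _; rewrite /ext; case: ifPn => // s0.
    by rewrite lee_fin; case/andP: (p01 s s0).
  exact: (trunc_green_cvg mp p01 c0 p_asymp a1).
Qed.
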